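(* Let $t\in U\otimes V\otimes W$ be a block tensor with respect to direct sum decompositions of $U,V,W$ indexed by finite sets $\mathcal A,\mathcal B,\mathcal C$, let $\Phi=\operatorname{supp}t\subseteq\mathcal A\times\mathcal B\times\mathcal C$, and suppose that the map $\mathcal P(\Phi)\to\mathcal P(\mathcal A)\times\mathcal P(\mathcal B)\times\mathcal P(\mathcal C)$ that maps a distribution to the collection of its marginals is injective. Let $k\in\mathbb N_{>0}$ and $P\in\mathcal P_k(\Phi)$. Then the sequence $a=(a_n)_{n\in\mathbb N}$ in the semiring of tensors given by \[a_n=t^{\otimes nk}[T^{nk}_P]\] is approximately geometric.
   Context: Semiring of tensors: a tensor is an element of $V_1\otimes V_2\otimes V_3$ with $V_j$ finite-dimensional complex vector spaces. A tensor $s\in V_1\otimes V_2\otimes V_3$ restricts to $t\in W_1\otimes W_2\otimes W_3$, written $t\le s$, if $t=(A_1\otimes A_2\otimes A_3)s$ for some linear maps $A_j:V_j\to W_j$; $s,t$ are equivalent if each restricts to the other. The set of equivalence classes of tensors, with direct sum $\oplus$ as addition, Kronecker (tensor) product $\otimes$ as multiplication and the preorder $\le$, is a preordered semiring. Natural numbers $r$ correspond to unit tensors $\langle r\rangle=\sum_{i=1}^re_i\otimes e_i\otimes e_i$. Approximately geometric sequences: $\mathbb N$ includes $0$; a sublinear sequence is a sequence $(k_n)_{n\in\mathbb N}$ in $\mathbb N$ with $k_n/n\to0$. Sequences of tensors satisfy $a\approx b$ if for some sublinear $(k_n)$ one has $a_n\le\langle2\rangle^{\otimes k_n}\otimes b_n$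 and $b_n\le\langle 2\rangle^{\otimes k_n}\otimes a_n$ for all $n$. A sequence $(a_n)_{n\in\mathbb N}$ is approximately geometric if either $a\approx(1,0,0,\dots)$, or all $a_n$ are nonzero and there is a sublinear sequence $(k_n)$ such that for all $r\in\mathbb N_{>0}$ and $n_1,\dots,n_r\in\mathbb N$ both $a_{n_1}\otimes\cdots\otimes a_{n_r}\le\langle2\rangle^{\otimes(k_{n_1}+\dots+k_{n_r})}\otimes a_{n_1+\dots+n_r}$ and $a_{n_1+\dots+n_r}\le\langle2\rangle^{\otimes(k_{n_1}+\dots+k_{n_r})}\otimes a_{n_1}\otimes\cdots\otimes a_{n_r}$ hold. Block tensors: let $U=\bigoplus_{i\in I}U^{(i)}$, $V=\bigoplus_{j\in J}V^{(j)}$, $W=\bigoplus_{k\in K}W^{(k)}$ be finite-dimensional complex vector spaces with direct sum decompositions indexed by finite sets, and let $E_i,E_j,E_k$ denote the corresponding projections onto the summands (followed by inclusion). A tensor $t\in U\otimes V\otimes W$ together with such decompositions is a block tensor, with blocks $t_{i,j,k}=(E_i\otimes E_j\otimes E_k)t$ and support $\operatorname{supp}t=\{(i,j,k):t_{i,j,k}\ne0\}$. For $\Psi\subseteq I\times J\times K$, $t[\Psi]=\sum_{(i,j,k)\in\Psi}t_{i,j,k}$. If $t$ is a block tensor with index sets $\mathcal A,\mathcal B,\mathcal C$, then $t^{\otimes m}\in U^{\otimes m}\otimes V^{\otimes m}\otimes W^{\otimes m}$ is a block tensor with index sets $\mathcal A^m,\mathcal B^m,\mathcal C^m$, where $(i_1,\dots,i_m)\in\mathcal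 A^m$ labels $U^{(i_1)}\otimes\cdots\otimes U^{(i_m)}$, and similarly for $V,W$; subsets of $(\mathcal A\times\mathcal B\times\mathcal C)^m$ are identified with subsets of $\mathcal A^m\times\mathcal B^m\times\mathcal C^m$. Types: $\mathcal P(\mathcal X)$ is the set of probability distributions on the finite set $\mathcal X$; $\mathcal P_n(\mathcal X)$ is the set of $P\in\mathcal P(\mathcal X)$ with $nP(x)\in\mathbb N$ for all $x\in\mathcal X$. For $P\in\mathcal P_n(\mathcal X)$, the type class $T^n_P\subseteq\mathcal X^n$ is the set of strings in which each $x\in\mathcal X$ occurs exactly $nP(x)$ times. *)

(* Defs.v *)
From HB Require Import structures.
From mathcomp Require Import all_boot all_order all_algebra.
From mathcomp Require Import complex.
From mathcomp Require Import classical_sets reals topology normedtype sequences.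

Set Implicit Arguments.
Unset Strict Implicit.
Unset Printing Implicit Defensive.

Import GRing.Theory Num.Theory.
Import numFieldNormedType.Exports.

Local Open Scope ring_scope.

(* Finite-dimensional vector spaces over [F] are taken in coordinates, as [F^X]
for an arbitrary finite type [X]; then [F^X (x) F^Y (x) F^Z] is
[F^(X * Y * Z)].  ([F^o] is [F] as a vector space over itself.) *)

Definition vec (F : fieldType) (X : finType) := {ffun X -> F^o}.

Definition tens (F : fieldType) (X Y Z : finType) := {ffun X * Y * Z -> F^o}.

Section Tensors.
Variable F : fieldType.

Definition basis_vec (X : finType) (x : X) : vec F X := [ffun x' => (x' == x)%:R].

Definition pure (X Y Z : finType) (u : vec F X) (v : vec F Y) (w : vec F Z) :
    tens F X Y Z :=
  [ffun p => u p.1.1 * v p.1.2 * w p.2].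

(* [(f (x) g (x) h) t], by linear extension from the basis
   [e_x (x) e_y (x) e_z]. *)
Definition tens_map (X Y Z X' Y' Z' : finType)
    (f : 'Hom(vec F X, vec F X')) (g : 'Hom(vec F Y, vec F Y'))
    (h : 'Hom(vec F Z, vec F Z')) (t : tens F X Y Z) : tens F X' Y' Z' :=
  \sum_(p : X * Y * Z)
    t p *: pure (f (basis_vec p.1.1)) (g (basis_vec p.1.2)) (h (basis_vec p.2)).

Definition tens_pow (X Y Z : finType) (m : nat) (t : tens F X Y Z) :
    tens F {ffun 'I_m -> X} {ffun 'I_m -> Y} {ffun 'I_m -> Z} :=
  [ffun p : {ffun 'I_m -> X} * {ffun 'I_m -> Y} * {ffun 'I_m -> Z} =>
    \prod_(l < m) t (p.1.1 l, p.1.2 l, p.2 l)].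

(* Elements of the preordered semiring of tensors are represented by tensors
   of arbitrary format; equality in the semiring is mutual [tensor_le]. *)
Record tensor := Tensor {
  ix1 : finType;
  ix2 : finType;
  ix3 : finType;
  tval : tens F ix1 ix2 ix3 }.

(* [s] restricts to [t]. *)
Definition tensor_le (t s : tensor) : Prop :=
  exists (f : 'Hom(vec F (ix1 s), vec F (ix1 t)))
         (g : 'Hom(vec F (ix2 s), vec F (ix2 t)))
         (h : 'Hom(vec F (ix3 s), vec F (ix3 t))),
    tval t = tens_map f g h (tval s).

Definition unit_tensor (r : nat) : tensor :=
  Tensor (\sum_(i < r) pure (basis_vec i) (basis_vec i) (basis_vec i)).

Definition kron (s t : tensor) : tensor :=
  @Tensor (ix1 s * ix1 t)%type (ix2 s * ix2 t)%type (ix3 s * ix3 t)%type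
    [ffun p => tval s (p.1.1.1, p.1.2.1, p.2.1) * tval t (p.1.1.2, p.1.2.2, p.2.2)].

Definition kron_pow (m : nat) (t : tensor) : tensor := Tensor (tens_pow m (tval t)).

Definition kron_seq (s : seq tensor) : tensor := foldr kron (unit_tensor 1) s.

End Tensors.

Definition sublinear (R : realType) (k : nat -> nat) : Prop :=
  ((fun n : nat => (k n)%:R / n%:R : R) @ \oo --> (0 : R))%classic.

Definition approx_eq (R : realType) (F : fieldType) (a b : nat -> tensor F) : Prop :=
  exists2 k : nat -> nat, sublinear R k &
    forall n, tensor_le (a n) (kron (kron_pow (k n) (unit_tensor F 2)) (b n)) /\
              tensor_le (b n) (kron (kron_pow (k n) (unit_tensor F 2)) (a n)).

Definition one_zero_seq (F : fieldType) (n : nat) : tensor F :=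
  if n is 0%N then unit_tensor F 1 else unit_tensor F 0.

Definition approx_geometric (R : realType) (F : fieldType) (a : nat -> tensor F) : Prop :=
  approx_eq R a (@one_zero_seq F) \/
  ((forall n, tval (a n) != 0) /\
   exists2 k : nat -> nat, sublinear R k &
     forall ns : seq nat, ns != [::] ->
       let c := kron_pow (\sum_(n <- ns) k n)%N (unit_tensor F 2) in
       let prod_a := kron_seq [seq a n | n <- ns] in
       let a_sum := a (\sum_(n <- ns) n)%N in
       tensor_le prod_a (kron c a_sum) /\ tensor_le a_sum (kron c prod_a)).

Section Blocks.
Variable F : fieldType.

Definition is_decomposition (X I : finType) (U : I -> {vspace vec F X}) : Prop :=
  directv (\sum_(i : I) U i)%VS /\ (\sum_(i : I) U i)%VS = fullv.

(* The projection onto the summand [U i] along the others. *)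
Definition block_proj (X I : finType) (U : I -> {vspace vec F X}) (i : I) :
    'Hom(vec F X, vec F X) :=
  sumv_pi (\sum_(j : I) U j)%VS i.

Definition block (X Y Z A B C : finType) (U : A -> {vspace vec F X})
    (V : B -> {vspace vec F Y}) (W : C -> {vspace vec F Z})
    (t : tens F X Y Z) (p : A * B * C) : tens F X Y Z :=
  tens_map (block_proj U p.1.1) (block_proj V p.1.2) (block_proj W p.2) t.

Definition block_supp (X Y Z A B C : finType) (U : A -> {vspace vec F X})
    (V : B -> {vspace vec F Y}) (W : C -> {vspace vec F Z})
    (t : tens F X Y Z) : {set A * B * C} :=
  [set p | block U V W t p != 0].

(* [t[Psi]] *)
Definition block_restr (X Y Z A B C : finType) (U : A -> {vspace vec F X})
    (V : B -> {vspace vec F Y}) (W : C -> {vspace vec F Z})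
    (t : tens F X Y Z) (Psi : {set A * B * C}) : tens F X Y Z :=
  \sum_(p in Psi) block U V W t p.

(* The vector [u_0 (x) ... (x) u_(m-1)] of [(F^X)^(x)m = F^(X^m)]. *)
Definition vec_prod (X : finType) (m : nat) (u : 'I_m -> vec F X) :
    vec F {ffun 'I_m -> X} :=
  [ffun x : {ffun 'I_m -> X} => \prod_(l < m) u l (x l)].

(* The summand of [(F^X)^(x)m] labelled by [i] is
   [U (i 0) (x) ... (x) U (i (m-1))], spanned by the products of basis vectors
   of the factors.  Indices [f l >= \dim (U (i l))] only contribute the zero
   vector, the default value of [s`_j]. *)
Definition pow_decomposition (X I : finType) (m : nat) (U : I -> {vspace vec F X})
    (i : {ffun 'I_m -> I}) : {vspace vec F {ffun 'I_m -> X}} :=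
  (\sum_(f : {ffun 'I_m -> 'I_(\dim {:vec F X})})
     <[vec_prod (fun l => (vbasis (U (i l)))`_(f l))]>)%VS.

End Blocks.

(* Subsets of [(A * B * C)^m] seen as subsets of [A^m * B^m * C^m]. *)
Definition unzip3 (A B C : finType) (m : nat) (s : {ffun 'I_m -> A * B * C}) :
    {ffun 'I_m -> A} * {ffun 'I_m -> B} * {ffun 'I_m -> C} :=
  ([ffun l => (s l).1.1], [ffun l => (s l).1.2], [ffun l => (s l).2]).

Section Types.
Variable R : realType.

(* Distributions on a subset [Phi] of [T] are identified with the distributions
   on [T] that vanish outside [Phi]. *)
Definition is_distr (T : finType) (Phi : {set T}) (P : {ffun T -> R}) : Prop :=
  [/\ forall x, 0 <= P x, \sum_x P x = 1 & forall x, x \notin Phi -> P x = 0].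

Definition is_ntype (T : finType) (n : nat) (Phi : {set T}) (P : {ffun T -> R}) : Prop :=
  is_distr Phi P /\ forall x, exists j : nat, n%:R * P x = j%:R.

Definition type_class (T : finType) (n : nat) (P : {ffun T -> R}) :
    {set {ffun 'I_n -> T}} :=
  [set s : {ffun 'I_n -> T} | [forall x, #|[set l | s l == x]|%:R == n%:R * P x]].

Definition marginals (A B C : finType) (P : {ffun A * B * C -> R}) :
    {ffun A -> R} * {ffun B -> R} * {ffun C -> R} :=
  ([ffun a => \sum_(p | p.1.1 == a) P p],
   [ffun b => \sum_(p | p.1.2 == b) P p],
   [ffun c => \sum_(p | p.2 == c) P p]).

End Types.

(* Main.v *)
(* A string over [Phi] whose segments have the A-, B- and C-marginals of [P] has
   segments of type [P], because marginals determine distributions on [Phi].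
   Hence the product of the [a_(n_j)] is cut out of [a_(n_1 + ... + n_r)] by
   conditions on the A-, B- and C-components separately, which is a restriction.

   Conversely, cut the positions of [a_N], [N = n_1 + ... + n_r], into pieces of
   length [L] and sort the strings by the types of all pieces.  Give segment [j]
   [floor (mu n_j / N)] of the [mu] pieces of each type: no letter is then
   overused, and the few letters in the remaining pieces exactly fill the
   deficits.  Sorting also by the letters in the remaining pieces, each cell is
   again cut out by conditions on the three components (by injectivity of the
   marginals) and is mapped into the product of the type classes of lengths
   [n_j] by one permutation of the positions.  So [a_N] is a sum of
   [2 ^ (N / h + c_h (r + 1))] restrictions of the product of the [a_(n_j)], for
   every [h] when [L] is large enough.  Applying this to lengths of comparable
   size only, with [h] growing with the size, and merging the sizes one by one
   gives a loss that is a sum of sublinear terms. *)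
Require Import Defs.
From HB Require Import structures.
From mathcomp Require Import all_boot all_order all_algebra.
From mathcomp Require Import complex.
From mathcomp Require Import boolp classical_sets reals topology normedtype sequences.
From mathcomp Require Import zify ring lra.

Set Implicit Arguments.
Unset Strict Implicit.
Unset Printing Implicit Defensive.

Import Order.TTheory GRing.Theory Num.Theory.
Import numFieldNormedType.Exports.

Local Open Scope ring_scope.

(* [tuple] also exports a [tval]. *)
Local Notation tval := Defs.tval.

(** * Finite sums and products *)

Lemma sum_mul (S : pzSemiRingType) (I J : finType) (f : I -> S) (g : J -> S) :
  (\sum_i f i) * (\sum_j g j) = \sum_p f p.1 * g p.2.
Proof.
rewrite mulr_suml -(pair_bigA _ (fun i j => f i * g j)) /=.
by apply: eq_bigr => i _; rewrite mulr_sumr.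
Qed.

Lemma prod_eq_ffun (S : comNzSemiRingType) (I : finType) (V : eqType) (s s' : {ffun I -> V}) :
  \prod_l (s l == s' l)%:R = (s == s')%:R :> S.
Proof.
case: eqP => [->|/eqP ne]; first by rewrite big1 // => l _; rewrite eqxx.
have [l nel] : exists l, s l != s' l.
  apply/existsP; apply: contraNT ne; rewrite negb_exists => /forallP h.
  by apply/eqP/ffunP => l; have := h l; rewrite negbK => /eqP.
by rewrite (bigD1 l) //= (negPf nel) mul0r.
Qed.

(** * Restrictions by kernels *)

Section Restriction.
Variable F : fieldType.
Implicit Types s t u : tensor F.

(** The action of [K1 (x) K2 (x) K3] in coordinates. Tensors enter as plain functions, so that
    applications can be nested. *)
Definition ker_app (X Y Z X' Y' Z' : finType) (K1 : X -> X' -> F) (K2 : Y -> Y' -> F)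
    (K3 : Z -> Z' -> F) (t : X * Y * Z -> F) (q' : X' * Y' * Z') : F :=
  \sum_q t q * (K1 q.1.1 q'.1.1 * K2 q.1.2 q'.1.2 * K3 q.2 q'.2).

Definition hom_ker (X X' : finType) (f : 'Hom(vec F X, vec F X')) (x : X) (x' : X') : F :=
  f (basis_vec F x) x'.

Lemma tens_mapE (X Y Z X' Y' Z' : finType)
    (f : 'Hom(vec F X, vec F X')) (g : 'Hom(vec F Y, vec F Y'))
    (h : 'Hom(vec F Z, vec F Z')) (t : tens F X Y Z) q :
  tens_map f g h t q = ker_app (hom_ker f) (hom_ker g) (hom_ker h) t q.
Proof.
rewrite /tens_map sum_ffunE; apply: eq_bigr => p _.
by rewrite !ffunE.
Qed.

Definition ker_fun (X X' : finType) (K : X -> X' -> F) (v : vec F X) : vec F X' :=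
  [ffun x' => \sum_x v x * K x x'].

Lemma ker_fun_linear (X X' : finType) (K : X -> X' -> F) : linear (@ker_fun X X' K).
Proof.
move=> a u v; apply/ffunP=> x'; rewrite !ffunE scaler_sumr -big_split /=.
by apply: eq_bigr => x _; rewrite !ffunE mulrDl scalerAl.
Qed.

HB.instance Definition _ (X X' : finType) (K : X -> X' -> F) :=
  GRing.isLinear.Build F (vec F X) (vec F X') _ (@ker_fun X X' K) (@ker_fun_linear X X' K).

Lemma hom_ker_fun (X X' : finType) (K : X -> X' -> F) x x' :
  hom_ker (linfun (@ker_fun X X' K)) x x' = K x x'.
Proof.
rewrite /hom_ker lfunE /= ffunE (bigD1 x) //= ffunE eqxx mul1r big1 ?addr0 // => y ne.
by rewrite ffunE (negPf ne) mul0r.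
Qed.

Lemma tensor_leP t s :
  tensor_le t s <-> exists (K1 : ix1 s -> ix1 t -> F) K2 K3,
    forall q, tval t q = ker_app K1 K2 K3 (tval s) q.
Proof.
split=> [[f [g [h def_t]]] | [K1 [K2 [K3 def_t]]]].
  by exists (hom_ker f), (hom_ker g), (hom_ker h) => q; rewrite def_t tens_mapE.
exists (linfun (ker_fun K1)), (linfun (ker_fun K2)), (linfun (ker_fun K3)).
apply/ffunP=> q; rewrite tens_mapE def_t; apply: eq_bigr => p _.
by rewrite !hom_ker_fun.
Qed.

(* [t] is a sum of [K] restrictions of [s], i.e. [t <= <K> (x) s]. *)
Definition sum_le (K : nat) (t s : tensor F) : Prop :=
  exists (K1 : nat -> ix1 s -> ix1 t -> F) (K2 : nat -> ix2 s -> ix2 t -> F)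
         (K3 : nat -> ix3 s -> ix3 t -> F),
    forall q, tval t q = \sum_(m < K) ker_app (K1 m) (K2 m) (K3 m) (tval s) q.

Lemma ker_app0 (X Y Z X' Y' Z' : finType) (K2 : Y -> Y' -> F)
    (K3 : Z -> Z' -> F) (t : X * Y * Z -> F) (q' : X' * Y' * Z') :
  ker_app (fun _ _ => 0) K2 K3 t q' = 0.
Proof. by rewrite /ker_app big1 // => q _; rewrite !mul0r mulr0. Qed.

Lemma sum_le_widen K K' t s : (K <= K')%N -> sum_le K t s -> sum_le K' t s.
Proof.
move=> leK [K1 [K2 [K3 def_t]]].
exists (fun m => if (m < K)%N then K1 m else fun _ _ => 0), K2, K3 => q.
rewrite def_t (big_ord_widen K' (fun m => ker_app (K1 m) (K2 m) (K3 m) (tval s) q)) //.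
rewrite big_mkcond; apply: eq_bigr => m _; case: ifP => // _.
by rewrite ker_app0.
Qed.

Lemma sum_le_of_fin (D : finType) t s (K1 : D -> ix1 s -> ix1 t -> F) K2 K3 :
    (forall q, tval t q = \sum_d ker_app (K1 d) (K2 d) (K3 d) (tval s) q) ->
  sum_le #|D| t s.
Proof.
move=> def_t.
(* The kernels are numbered by [enum_val]; the padding [k0] beyond [#|D|] is never summed. *)
pose ext T (k : D -> T) (k0 : T) (m : nat) := odflt k0 (omap (k \o enum_val) (insub m : option 'I_#|D|)).
exists (ext _ K1 (fun _ _ => 0)), (ext _ K2 (fun _ _ => 0)), (ext _ K3 (fun _ _ => 0)) => q.
rewrite def_t -(@eq_bigl _ _ _ _ _ (mem D)) // big_enum_val /=.
by apply: eq_bigr => m _; rewrite /ext valK.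
Qed.

Lemma sum_le_fin (D : finType) t s : sum_le #|D| t s ->
  exists (K1 : D -> ix1 s -> ix1 t -> F) K2 K3,
    forall q, tval t q = \sum_d ker_app (K1 d) (K2 d) (K3 d) (tval s) q.
Proof.
move=> [K1 [K2 [K3 def_t]]].
exists (K1 \o enum_rank), (K2 \o enum_rank), (K3 \o enum_rank) => q /=.
rewrite def_t (reindex (@enum_rank D)) //=; apply: onW_bij; exact: enum_rank_bij.
Qed.

Lemma tensor_le_sum t s : tensor_le t s <-> sum_le 1 t s.
Proof.
rewrite tensor_leP; split=> [[K1 [K2 [K3 def_t]]] | [K1 [K2 [K3 def_t]]]].
  by exists (fun=> K1), (fun=> K2), (fun=> K3) => q; rewrite big_ord1.
by exists (K1 0%N), (K2 0%N), (K3 0%N) => q; rewrite def_t big_ord1.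
Qed.

Lemma ker_app_comp (X Y Z X' Y' Z' X'' Y'' Z'' : finType)
    (K1 : X -> X' -> F) (K2 : Y -> Y' -> F) (K3 : Z -> Z' -> F)
    (L1 : X' -> X'' -> F) (L2 : Y' -> Y'' -> F) (L3 : Z' -> Z'' -> F)
    (t : X * Y * Z -> F) (q : X'' * Y'' * Z'') :
  ker_app L1 L2 L3 (ker_app K1 K2 K3 t) q =
  ker_app (fun x x'' => \sum_x' K1 x x' * L1 x' x'')
          (fun y y'' => \sum_y' K2 y y' * L2 y' y'')
          (fun z z'' => \sum_z' K3 z z' * L3 z' z'') t q.
Proof.
rewrite /ker_app.
under eq_bigr do rewrite mulr_suml.
rewrite exchange_big; apply: eq_bigr => q0 _ /=.
rewrite !sum_mul /=.
under eq_bigr do rewrite -mulrA.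
rewrite -mulr_sumr; congr (_ * _).
apply: eq_bigr => q' _.
by rewrite [in RHS](mulrACA (K1 _ _)) [RHS]mulrACA.
Qed.

(** By linearity each summand of [u] expands over the summands of [t], which gives one composed
    restriction of [s] per pair of indices. *)
Lemma sum_le_trans K L s t u : sum_le K t s -> sum_le L u t -> sum_le (K * L) u s.
Proof.
move=> le_ts le_ut.
have [K1 [K2 [K3 def_t]]] : exists (K1 : 'I_K -> ix1 s -> ix1 t -> F) K2 K3,
    forall q, tval t q = \sum_d ker_app (K1 d) (K2 d) (K3 d) (tval s) q.
  by apply: sum_le_fin; rewrite card_ord.
have [L1 [L2 [L3 def_u]]] : exists (K1 : 'I_L -> ix1 t -> ix1 u -> F) K2 K3,
    forall q, tval u q = \sum_d ker_app (K1 d) (K2 d) (K3 d) (tval t) q.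
  by apply: sum_le_fin; rewrite card_ord.
have -> : (K * L)%N = #|{: 'I_K * 'I_L}| by rewrite card_prod !card_ord.
pose cmp (x x' x'' : finType) (k1 : 'I_K -> x -> x' -> F) (l1 : 'I_L -> x' -> x'' -> F)
  (d : 'I_K * 'I_L) a c := \sum_b k1 d.1 a b * l1 d.2 b c.
apply: (@sum_le_of_fin _ u s (cmp _ _ _ K1 L1) (cmp _ _ _ K2 L2) (cmp _ _ _ K3 L3)) => q.
rewrite def_u.
rewrite -(pair_bigA _ (fun i j => ker_app (cmp _ _ _ K1 L1 (i, j)) (cmp _ _ _ K2 L2 (i, j))
  (cmp _ _ _ K3 L3 (i, j)) (tval s) q)) /= [RHS]exchange_big.
apply: eq_bigr => j _ /=.
transitivity (\sum_i ker_app (L1 j) (L2 j) (L3 j)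
   (ker_app (K1 i) (K2 i) (K3 i) (tval s)) q); last first.
  by apply: eq_bigr => i _; rewrite ker_app_comp.
rewrite /ker_app exchange_big; apply: eq_bigr => q' _ /=.
by rewrite -mulr_suml def_t.
Qed.

Lemma big_pair3 (X X' Y Y' Z Z' : finType) (f : X * Y * Z -> X' * Y' * Z' -> F) :
  \sum_(q : (X * X') * (Y * Y') * (Z * Z'))
     f (q.1.1.1, q.1.2.1, q.2.1) (q.1.1.2, q.1.2.2, q.2.2) =
  \sum_q \sum_q' f q q'.
Proof.
rewrite pair_big /=.
rewrite (reindex (fun d : (X * Y * Z) * (X' * Y' * Z') =>
  ((d.1.1.1, d.2.1.1), (d.1.1.2, d.2.1.2), (d.1.2, d.2.2)))) /=.
  by apply: eq_bigr => -[[[x y] z] [[x' y'] z']].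
by exists (fun q : (X * X') * (Y * Y') * (Z * Z') =>
    ((q.1.1.1, q.1.2.1, q.2.1), (q.1.1.2, q.1.2.2, q.2.2)))
  => [[[[x y] z] [[x' y'] z']]|[[[x x'] [y y']] [z z']]].
Qed.

Lemma sum_le_kron K L s t s' t' :
  sum_le K t s -> sum_le L t' s' -> sum_le (K * L) (kron t t') (kron s s').
Proof.
move=> le_ts le_ut.
have [K1 [K2 [K3 def_t]]] : exists (K1 : 'I_K -> ix1 s -> ix1 t -> F) K2 K3,
    forall q, tval t q = \sum_d ker_app (K1 d) (K2 d) (K3 d) (tval s) q.
  by apply: sum_le_fin; rewrite card_ord.
have [L1 [L2 [L3 def_u]]] : exists (K1 : 'I_L -> ix1 s' -> ix1 t' -> F) K2 K3,
    forall q, tval t' q = \sum_d ker_app (K1 d) (K2 d) (K3 d) (tval s') q.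
  by apply: sum_le_fin; rewrite card_ord.
have -> : (K * L)%N = #|{: 'I_K * 'I_L}| by rewrite card_prod !card_ord.
pose cmp (x x' y y' : finType) (k1 : 'I_K -> x -> x' -> F) (l1 : 'I_L -> y -> y' -> F)
  (d : 'I_K * 'I_L) (a : x * y) (c : x' * y') := k1 d.1 a.1 c.1 * l1 d.2 a.2 c.2.
apply: (@sum_le_of_fin _ (kron t t') (kron s s') (cmp _ _ _ _ K1 L1) (cmp _ _ _ _ K2 L2) (cmp _ _ _ _ K3 L3)) => q.
rewrite ffunE def_t def_u sum_mul /=.
apply: eq_bigr => d _; rewrite /ker_app sum_mul /=.
pose f (a : ix1 s * ix2 s * ix3 s) (b : ix1 s' * ix2 s' * ix3 s') :=
  tval s a * (K1 d.1 a.1.1 q.1.1.1 * K2 d.1 a.1.2 q.1.2.1 * K3 d.1 a.2 q.2.1) *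
  (tval s' b * (L1 d.2 b.1.1 q.1.1.2 * L2 d.2 b.1.2 q.1.2.2 * L3 d.2 b.2 q.2.2)).
rewrite -(pair_bigA _ f) -(big_pair3 f).
apply: eq_bigr => q' _; rewrite /f /cmp ffunE /=; ring.
Qed.

(** The power is again diagonal: it is the unit tensor with basis the [2 ^ e] binary words. *)
Lemma kron_pow_unitE e (w : {ffun 'I_e -> 'I_2} * {ffun 'I_e -> 'I_2} * {ffun 'I_e -> 'I_2}) :
  tval (kron_pow e (unit_tensor F 2)) w = ((w.1.1 == w.1.2) && (w.1.1 == w.2))%:R.
Proof.
case: w => [[w1 w2] w3] /=; rewrite ffunE /=.
have E l : tval (unit_tensor F 2) (w1 l, w2 l, w3 l) = ((w1 l == w2 l) && (w1 l == w3 l))%:R.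
  rewrite /= sum_ffunE (bigD1 (w1 l)) //= big1 => [|i ne]; rewrite !ffunE /=.
    by rewrite eqxx mul1r -natrM mulnb addr0 ![_ == w1 l]eq_sym.
  by rewrite eq_sym (negPf ne) !mul0r.
under eq_bigr do rewrite E -mulnb natrM.
by rewrite big_split /= !prod_eq_ffun -natrM mulnb.
Qed.

(** Binary words of length [e] number the summands. Each of the three legs picks the kernel of its
    own word, and the diagonal factor forces the words to coincide. *)
Lemma sum_le_tensor_le e t s :
  sum_le (2 ^ e) t s -> tensor_le t (kron (kron_pow e (unit_tensor F 2)) s).
Proof.
move=> le_ts.
have [K1 [K2 [K3 def_t]]] : exists (K1 : {ffun 'I_e -> 'I_2} -> ix1 s -> ix1 t -> F) K2 K3,
    forall q, tval t q = \sum_d ker_app (K1 d) (K2 d) (K3 d) (tval s) q.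
  by apply: sum_le_fin; rewrite card_ffun !card_ord.
apply/tensor_leP.
exists (fun p x' => K1 p.1 p.2 x'), (fun p x' => K2 p.1 p.2 x'), (fun p x' => K3 p.1 p.2 x') => q.
rewrite def_t /ker_app.
pose f (w : {ffun 'I_e -> 'I_2} * {ffun 'I_e -> 'I_2} * {ffun 'I_e -> 'I_2}) (q' : ix1 s * ix2 s * ix3 s) :=
  ((w.1.1 == w.1.2) && (w.1.1 == w.2))%:R * tval s q' *
  (K1 w.1.1 q'.1.1 q.1.1 * K2 w.1.2 q'.1.2 q.1.2 * K3 w.2 q'.2 q.2).
transitivity (\sum_w \sum_q' f w q'); last first.
  rewrite -(big_pair3 f); apply: eq_bigr => p _; rewrite /f ffunE /=.
  by rewrite (@kron_pow_unitE e (p.1.1.1, p.1.2.1, p.2.1)).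
rewrite (bigID (fun w => (w.1.1 == w.1.2) && (w.1.1 == w.2))) /= [X in _ + X]big1 ?addr0; last first.
  by move=> w nw; rewrite big1 // => q' _; rewrite /f (negPf nw) !mul0r.
rewrite (reindex_onto (fun w => (w, w, w)) (fun w => w.1.1)) /=; last first.
  by move=> [[a b] c] /= /andP[/eqP <- /eqP <-].
rewrite [RHS](eq_bigl xpredT) => [|w]; last by rewrite !eqxx.
by apply: eq_bigr => w _; apply: eq_bigr => q' _; rewrite /f /= !eqxx mul1r.
Qed.

(** Pulling coordinates back along maps is a restriction by 0/1 matrices. Reorderings of factors and
    changes of index sets are all obtained this way. *)
Lemma tensor_le_reindex t s (f1 : ix1 t -> ix1 s) f2 f3 :
    (forall q, tval t q = tval s (f1 q.1.1, f2 q.1.2, f3 q.2)) ->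
  tensor_le t s.
Proof.
move=> def_t; apply/tensor_leP.
exists (fun x x' => (x == f1 x')%:R), (fun x x' => (x == f2 x')%:R), (fun x x' => (x == f3 x')%:R) => q.
rewrite def_t /ker_app (bigD1 (f1 q.1.1, f2 q.1.2, f3 q.2)) //= !eqxx !mulr1 big1 ?addr0 //.
move=> [[x y] z]; rewrite !xpair_eqE /=.
case: (x == _) => [|_]; last by rewrite !mul0r mulr0.
case: (y == _) => [|_]; last by rewrite mulr0 mul0r mulr0.
by case: (z == _) => // _; rewrite !mulr0.
Qed.

Lemma tensor_le_refl t : tensor_le t t.
Proof. by apply: (@tensor_le_reindex t t id id id) => -[[x y] z]. Qed.

Lemma tensor_le_trans s t u : tensor_le t s -> tensor_le u t -> tensor_le u s.
Proof.
rewrite !tensor_le_sum => h1 h2.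
by have := sum_le_trans h1 h2; rewrite mul1n.
Qed.

Lemma tensor_le_kron s t s' t' :
  tensor_le t s -> tensor_le t' s' -> tensor_le (kron t t') (kron s s').
Proof.
rewrite !tensor_le_sum => h1 h2.
by have := sum_le_kron h1 h2; rewrite mul1n.
Qed.

End Restriction.

(** * Cells of a type class *)

Section Counting.
Local Open Scope nat_scope.

Lemma card_fibers (I J : finType) (b : I -> J) (P : pred J) (Q : pred I) :
  #|[set l | P (b l) && Q l]| = \sum_(c | P c) #|[set l | (b l == c) && Q l]|.
Proof.
rewrite -sum1dep_card (partition_big b P) => [|l /andP[] //].
apply: eq_bigr => c Pc; rewrite -sum1dep_card; apply: eq_bigl => l.
by case: (b l =P c) => [->|]; rewrite ?andbF ?Pc ?andbT.
Qed.

Lemma card_values (J : finType) (P : pred J) (g : J -> nat) r :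
  #|[set y | P y]| =
  \sum_(j < r) #|[set y | P y && (g y == j)]| + #|[set y | P y && (r <= g y)]|.
Proof.
elim: r => [|r IH]; first by rewrite big_ord0; apply: eq_card => y; rewrite !inE andbT.
rewrite IH big_ord_recr /= -addnA; congr (_ + _).
rewrite -cardsUI [X in _ = _ + X]eq_card0 ?addn0 => [|y]; last first.
  by rewrite !inE; case: (ltngtP (g y) r); rewrite ?andbF.
by apply: eq_card => y; rewrite !inE; case: (P y) => //=; rewrite leq_eqVlt eq_sym.
Qed.

(** Greedy choice: the first [d] elements of [D] get the value 0, and the others are treated
    recursively with values shifted by one. *)
Lemma distribute (J : finType) (D : {set J}) (ds : seq nat) : sumn ds <= #|D| ->
  exists g : J -> nat, forall j, j < size ds -> #|[set y in D | g y == j]| = nth 0 ds j.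
Proof.
elim: ds D => [|d ds IH] D /= leD; first by exists (fun=> 0).
pose D0 := [set y in take d (enum D)].
have cardD0 : #|D0| = d.
  rewrite cardsE; have /card_uniqP -> := take_uniq d (enum_uniq D).
  by rewrite size_takel // -cardE (leq_trans _ leD) ?leq_addr.
have sD0 : D0 \subset D by apply/fintype.subsetP => y; rewrite inE => /mem_take; rewrite mem_enum.
have [|g gP] := IH (D :\: D0); first by rewrite cardsDS // cardD0 leq_subRL ?(leq_trans _ leD) ?leq_addr.
exists (fun y => if y \in D0 then 0 else (g y).+1) => -[_|j lt_j] /=.
  rewrite -[RHS]cardD0; apply: eq_card => y; rewrite !inE.
  case: ifP => [yD0|_]; last by rewrite andbF.
  by rewrite andbT (fintype.subsetP sD0) // inE.
rewrite -gP //; apply: eq_card => y; rewrite !inE.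
by case: ifP => //= _; rewrite ?andbF.
Qed.

Lemma sumn_divn_le N mu ns : sumn [seq mu * n %/ N | n <- ns] <= mu * sumn ns %/ N.
Proof.
elim: ns => [|n ns IH] /=; first by rewrite muln0.
apply: leq_trans (leq_add (leqnn _) IH) _.
case: N {IH} => [|N]; first by rewrite !divn0.
by rewrite leq_divRL // mulnDl mulnDr leq_add ?leq_divM.
Qed.

(** Rounding down loses at most one per entry, which bounds the number of pieces of one type that
    are left over. *)
Lemma sumn_divn_ge N mu ns :
  mu * sumn ns %/ N <= sumn [seq mu * n %/ N | n <- ns] + size ns.
Proof.
elim: ns => [|n ns IH] /=; first by rewrite muln0 div0n.
rewrite mulnDr; apply: leq_trans (leq_divDl _ _ _) _.
by rewrite addn1 addnS ltnS -addnA leq_add2l.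
Qed.

Lemma sumn_ord (f : nat -> nat) r : sumn (mkseq f r) = \sum_(j < r) f j.
Proof. by rewrite sumnE big_map -{1}(subn0 r) big_mkord. Qed.

Section Cells.
Variables (T : finType) (p : T -> nat) (ns : seq nat) (I : finType).
Let r := size ns.
Let N := sumn ns.

Definition balanced (s : {ffun I -> T}) := [forall x, #|[set l | s l == x]| == N * p x].

Definition good (g : I -> nat) (s : {ffun I -> T}) :=
  forall j x, j < r -> #|[set l | (g l == j) && (s l == x)]| = nth 0 ns j * p x.

Variables (q L : nat) (b : I -> 'I_q).
Hypothesis b_small : forall c, #|[set l | b l == c]| <= L.

(** Counts take values in ['I_L.+1] so that their number is explicit; [b_small] keeps [inord]
    exact. *)
Definition piece_count (s : {ffun I -> T}) : {ffun 'I_q * T -> 'I_L.+1} :=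
  [ffun cx => inord #|[set l | (b l == cx.1) && (s l == cx.2)]|].

Lemma piece_countE s c x : piece_count s (c, x) = #|[set l | (b l == c) && (s l == x)]| :> nat.
Proof.
rewrite ffunE inordK //= ltnS; apply: leq_trans (b_small c).
by apply: subset_leq_card; apply/fintype.subsetP => l; rewrite !inE => /andP[].
Qed.

Definition piece_type (tau : {ffun 'I_q * T -> 'I_L.+1}) (c : 'I_q) : {ffun T -> 'I_L.+1} :=
  [ffun x => tau (c, x)].

(* [floor (mu n_j / N)] pieces of each type go to segment [j]; the value [>= r]
   marks the pieces that are left over. *)
Lemma alloc (tau : {ffun 'I_q * T -> 'I_L.+1}) : exists g0 : 'I_q -> nat,
  (forall th j, j < r -> #|[set c | (piece_type tau c == th) && (g0 c == j)]| =
     #|[set c | piece_type tau c == th]| * nth 0 ns j %/ N) /\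
  (0 < N -> #|[set c | r <= g0 c]| <= r * #|{: {ffun T -> 'I_L.+1}}|).
Proof.
pose mu th := #|[set c | piece_type tau c == th]|.
pose ds th := [seq mu th * n %/ N | n <- ns].
have /boolp.choice[h hP] : forall th, exists h : 'I_q -> nat, forall j, j < size (ds th) ->
    #|[set c in [set c | piece_type tau c == th] | h c == j]| = nth 0 (ds th) j.
  move=> th; apply: distribute.
  apply: leq_trans (sumn_divn_le _ _ _) _; rewrite -/N.
  by case: (N) => [|N']; rewrite ?divn0 // mulnK.
have gP th j : j < r -> #|[set c | (piece_type tau c == th) && (h (piece_type tau c) c == j)]| =
     mu th * nth 0 ns j %/ N.
  move=> lt_j; have := hP th j; rewrite size_map => /(_ lt_j).
  rewrite (nth_map 0) // => <-; apply: eq_card => c; rewrite !inE.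
  by case: eqP => //= ->.
exists (fun c => h (piece_type tau c) c); split=> [//|N0].
pose Q c := r <= h (piece_type tau c) c.
have -> : [set c | Q c] = [set c | predT (piece_type tau c) && Q c] by [].
rewrite card_fibers mulnC -sum_nat_const; apply: leq_sum => th _.
(* With the allocated pieces of type [th] added, the left side counts all pieces of that type, from
   which rounding took at most [r]. *)
rewrite -(leq_add2l (\sum_(j < r) #|[set c | (piece_type tau c == th) && (h (piece_type tau c) c == j)]|)).
rewrite -card_values (eq_bigr (fun j : 'I_r => mu th * nth 0 ns j %/ N)); last by move=> j _; rewrite gP.
have := sumn_divn_ge N (mu th) ns; rewrite -/N mulnK //.
rewrite -/(mu th) => /leq_trans; apply; rewrite leq_add2r.
by rewrite sumnE big_map (big_nth 0) big_mkord.
Qed.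

Let rho := L * (r * #|{: {ffun T -> 'I_L.+1}}|).

Hypothesis I_empty : N = 0 -> #|I| = 0.

(* [rest] is the set of positions in the pieces that are left over; the value of
   [delta] records the type of every piece and the letters at these positions. *)
Lemma cells : exists (delta : {ffun I -> T} -> {ffun 'I_q * T -> 'I_L.+1} * {ffun 'I_rho -> option T})
    (rest : {ffun 'I_q * T -> 'I_L.+1} -> {set I})
    (g : {ffun 'I_q * T -> 'I_L.+1} * {ffun 'I_rho -> option T} -> I -> nat),
  (forall s s', delta s = delta s' <->
     piece_count s = piece_count s' /\ {in rest (piece_count s), s =1 s'}) /\
  (forall s, balanced s -> (forall l, g (delta s) l < r) /\ good (g (delta s)) s).
Proof.
have [G0 G0P] := boolp.choice alloc.
pose rest tau := [set l | r <= G0 tau (b l)].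
have rest_small tau : #|rest tau| <= rho.
  have [N0|] := posnP N.
    by apply: leq_trans (max_card _) _; rewrite I_empty.
  case: (G0P tau) => _ /[apply] le_rest.
  apply: leq_trans (leq_mul (leqnn L) le_rest); rewrite mulnC -sum_nat_const.
  have -> : rest tau = [set l | [pred c | r <= G0 tau c] (b l) && predT l].
    by apply/setP => l; rewrite !inE andbT.
  rewrite card_fibers (eq_bigl (mem [set c | r <= G0 tau c])) => [|c]; last by rewrite !inE.
  apply: leq_sum => c _; apply: leq_trans (b_small c).
  by apply: subset_leq_card; apply/fintype.subsetP => l; rewrite !inE andbT.
(* The letters at the left over positions are listed in the order of enumeration and padded with
   [None] up to length [rho]; [rest_small] ensures that the list fits. *)
pose delta s := (piece_count s,
  [ffun i : 'I_rho => nth None [seq Some (s l) | l <- enum (rest (piece_count s))] i]).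
have deltaP s s' : delta s = delta s' <->
     piece_count s = piece_count s' /\ {in rest (piece_count s), s =1 s'}.
  split=> [[eq_c /ffunP eq_s]|[eq_c eq_s]].
    split=> // l l_rest.
    have lt_i : index l (enum (rest (piece_count s))) < #|rest (piece_count s)|.
      by rewrite cardE index_mem mem_enum.
    have := eq_s (Ordinal (leq_trans lt_i (rest_small _))); rewrite !ffunE -eq_c /=.
    rewrite !(nth_map l) -?cardE // nth_index ?mem_enum //; by case.
  congr pair => //; apply/ffunP => i; rewrite !ffunE -eq_c; congr nth.
  by apply/eq_in_map => l; rewrite mem_enum => /eq_s ->.
exists delta, rest.
(* Each value [d] of [delta] gets its own assignment, built from one representative [s0] of its
   cell. *)
suff : forall d, exists g : I -> nat, forall s, balanced s -> delta s = d ->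
    (forall l, g l < r) /\ good g s.
  by case/boolp.choice=> g gP; exists g; split=> // s bal_s; exact: gP.
move=> d; have [[s0 bal0 s0d]|no_s] := pselect (exists2 s0, balanced s0 & delta s0 = d); last first.
  by exists (fun=> 0) => s bal_s sd; case: no_s; exists s.
rewrite -s0d {d s0d}.
set tau := piece_count s0.
(* The occurrences of [x] in the whole pieces given to segment [j]; by [alphaE] their number depends
   on the piece counts only. *)
pose alpha j x := #|[set l | (G0 tau (b l) == j) && (s0 l == x)]|.
have alphaE s j x : piece_count s = tau -> #|[set l | (G0 tau (b l) == j) && (s l == x)]| =
    \sum_(c | G0 tau c == j) tau (c, x).
  move=> ctau; rewrite (card_fibers b (fun c => G0 tau c == j)); apply: eq_bigr => c _.
  by rewrite -ctau piece_countE.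
have countE x : \sum_c tau (c, x) = N * p x.
  rewrite -(eqP (forallP bal0 x)).
  have -> : [set l | s0 l == x] = [set l | predT (b l) && (s0 l == x)] by [].
  by rewrite card_fibers; apply: eq_bigr => c _; rewrite -piece_countE.
(* No letter is overused: after multiplication by [N], the pieces are grouped by type, and segment
   [j] has at most the fraction [n_j / N] of each group. *)
have alpha_le j x : j < r -> alpha j x <= nth 0 ns j * p x.
  move=> lt_j; have [N0|N0] := posnP N.
    by rewrite /alpha (leq_trans (max_card _)) // I_empty.
  rewrite /alpha alphaE // -(leq_pmul2r N0).
  rewrite (partition_big (piece_type tau) xpredT) //= big_distrl /=.
  have -> : nth 0 ns j * p x * N = \sum_th (\sum_(c | piece_type tau c == th) tau (c, x)) * nth 0 ns j.
    rewrite -big_distrl -(partition_big (piece_type tau) xpredT (P := xpredT)) //= countE.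
    by ring.
  apply: leq_sum => th _.
  rewrite (eq_bigr (fun=> val (th x))) => [|c /andP[_ /eqP <-]]; last by rewrite [piece_type _ _ _]ffunE.
  rewrite [in X in _ <= X](eq_bigr (fun=> val (th x))) => [|c /eqP <-]; last by rewrite [piece_type _ _ _]ffunE.
  rewrite !sum_nat_cond_const mulnAC [X in _ <= X]mulnAC leq_mul2r; apply/orP; right.
  apply: (@leq_trans (#|[set c | (piece_type tau c == th) && (G0 tau c == j)]| * N)).
    rewrite leq_mul2r; apply/orP; right; apply: subset_leq_card.
    by apply/fintype.subsetP => c; rewrite !inE andbC.
  by rewrite (G0P tau).1 // leq_divM.
(* For each letter [x], the left over positions that carry [x] are shared out so as to fill the
   deficits of the segments. *)
have /boolp.choice[h hP] : forall x, exists h : I -> nat,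
    (forall l, l \in rest tau -> s0 l = x -> h l < r) /\
    (forall j, j < r -> #|[set l | (l \in rest tau) && (s0 l == x) && (h l == j)]| =
                nth 0 ns j * p x - alpha j x).
  move=> x.
  pose ds := mkseq (fun j => nth 0 ns j * p x - alpha j x) r.
  (* The deficits exhaust these positions exactly, because [balanced] fixes the total number of
     occurrences of [x]. *)
  have sum_ds : sumn ds = #|[set l | (l \in rest tau) && (s0 l == x)]|.
    rewrite sumn_ord; apply/eqP; rewrite -(eqn_add2l (\sum_(j < r) alpha j x)) -big_split /=.
    rewrite (eq_bigr (fun j : 'I_r => nth 0 ns j * p x)) => [|j _]; last by rewrite subnKC ?alpha_le.
    rewrite -big_distrl /=.
    have -> : \sum_(i < r) nth 0 ns i = N by rewrite /N sumnE (big_nth 0) big_mkord.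
    rewrite -(eqP (forallP bal0 x)) (card_values (fun l => s0 l == x) (fun l => G0 tau (b l)) r).
    apply/eqP; congr (_ + _).
      by apply: eq_bigr => j _; apply: eq_card => l; rewrite !inE andbC.
    by apply: eq_card => l; rewrite !inE andbC.
  have [|hx hxP] := @distribute _ [set l | (l \in rest tau) && (s0 l == x)] ds; first by rewrite sum_ds.
  have hxE j : j < r -> #|[set l | (l \in rest tau) && (s0 l == x) && (hx l == j)]| =
                nth 0 ns j * p x - alpha j x.
    move=> lt_j; have := hxP j; rewrite size_mkseq nth_mkseq // => /(_ lt_j) <-.
    by apply: eq_card => l; rewrite !inE.
  exists hx; split=> // l l_rest s0l.
  (* As the deficits use up all these positions, none is left with a value [>= r]. *)
  have := card_values (fun l => (l \in rest tau) && (s0 l == x)) hx r.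
  rewrite -sum_ds sumn_ord [X in _ = X + _](eq_bigr (fun j : 'I_r => nth 0 ns j * p x - alpha j x)) => [|j _]; last by rewrite hxE.
  move/eqP; rewrite -{1}[X in X == _]addn0 eqn_add2l eq_sym cards_eq0 => /eqP/setP/(_ l).
  by rewrite !inE s0l eqxx; move: l_rest; rewrite inE => -> /= ge_r; rewrite ltnNge ge_r.
(* At left over positions every string of the cell has the letters of [s0], so one assignment serves
   the whole cell. *)
exists (fun l => if l \in rest tau then h (s0 l) l else G0 tau (b l)) => s _ /deltaP[ctau s_rest].
rewrite ctau -/tau in s_rest.
split=> [l|j x lt_j].
  case: ifP => l_rest; first exact: (hP _).1.
  by move: l_rest; rewrite inE leqNgt => /negbFE.
rewrite -(subnKC (alpha_le j x lt_j)) -(hP x).2 // /alpha alphaE // -(alphaE s) //.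
rewrite -cardsUI [X in _ = _ + X]eq_card0 ?addn0 => [|l]; last first.
  rewrite !inE; case: eqP => //= ->; rewrite leqNgt lt_j /=; by rewrite andbF.
apply: eq_card => l; rewrite !inE.
case: ifP => l_rest.
  have -> : G0 tau (b l) == j = false by apply/eqP => e; rewrite e leqNgt lt_j in l_rest.
  rewrite s_rest ?inE //=; case: (s0 l =P x) => [->|] //=; by rewrite ?andbT ?andbF.
by rewrite orbF.
Qed.

End Cells.

End Counting.

(** * Splitting across scales *)

Section Diagonal.
(** [split ns e] abstracts the assertion that the tensor of length [sumn ns] is a sum of [2 ^ e]
    restrictions of the product of the tensors of the lengths in [ns]. *)
Variables (R : realType) (split : seq nat -> nat -> Prop).
Hypothesis split_mono : forall ns e e', (e <= e')%N -> split ns e -> split ns e'.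
Hypothesis split_perm : forall ns ns' e, perm_eq ns ns' -> split ns e -> split ns' e.
Hypothesis split_cat : forall ns1 ns2 e e1 e2,
  split [:: sumn ns1; sumn ns2] e -> split ns1 e1 -> split ns2 e2 ->
  split (ns1 ++ ns2) (e + e1 + e2)%N.
Variable C : nat -> nat.
Hypothesis splitH : forall h ns, (0 < h)%N -> split ns (sumn ns %/ h + C h * (size ns).+1)%N.

(* Lengths [n] with [scale n = g] are split with [h = 2 ^ g]; from the threshold
   on, the overhead [C h] per segment is at most [n / (5 h)], where 5 covers the
   [size + 1] segments of one scale and the merge with the smaller scales. *)
Definition threshold (g : nat) : nat := if g is 0 then 0 else (2 ^ g * (5 * C (2 ^ g)))%N.

Definition scale (n : nat) : nat := \max_(g < n.+1 | (threshold g <= n)%N) g.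

(** The maximum is attained at an admissible index, since [threshold 0 = 0] makes 0 admissible. *)
Lemma threshold_scale n : (threshold (scale n) <= n)%N.
Proof.
have [g tg ->] : {g : 'I_n.+1 | (threshold g <= n)%N & scale n = g}.
  by apply: eq_bigmax_cond; apply/card_gt0P; exists ord0.
by [].
Qed.

(** Shows that [scale] tends to infinity; [g <= n] is required by the range of the maximum. *)
Lemma scale_ge g n : (maxn g (threshold g) <= n)%N -> (g <= scale n)%N.
Proof.
rewrite geq_max => /andP[gn tn].
by apply: (@leq_bigmax_cond _ (fun g : 'I_n.+1 => (threshold g <= n)%N) (fun g => val g) (Ordinal (gn : (g < n.+1)%N))).
Qed.

(* The term [- n / 2 ^ g] pays for the merges with the scales above [g], whose
   costs form a geometric series. *)
Let weight (g n : nat) : rat := (C 1)%:R + n%:R * (4 / 2 ^+ scale n - 1 / 2 ^+ g).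

Lemma natr_divn_le (m d : nat) : (0 < d)%N -> (m %/ d)%:R <= m%:R / d%:R :> rat.
Proof.
by move=> d0; rewrite ler_pdivlMr ?ltr0n // -natrM ler_nat leq_divM.
Qed.

(** Induction on the largest scale. The lengths of scale [g + 1] are split with [h = 2 ^ (g + 1)],
    the lower ones by induction, and a two-term split with the same [h] joins both groups. *)
Lemma split_scale g ns : (forall n, n \in ns -> (scale n <= g)%N) ->
  exists2 e, split ns e & e%:R <= (C 1)%:R + \sum_(n <- ns) weight g n.
Proof.
elim: g ns => [|g IH] ns le_g.
  exists (sumn ns %/ 1 + C 1 * (size ns).+1)%N; first exact: splitH.
  rewrite divn1 mulnS natrD natrD addrCA lerD2l.
  elim: ns le_g => [|n ns IHs] le_g; first by rewrite big_nil /= muln0 addr0.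
  rewrite big_cons /= natrD mulnS natrD.
  have := IHs (fun m mns => le_g m (mem_behead (s := n :: ns) mns)).
  have : scale n = 0%N by apply/eqP; rewrite -leqn0 le_g ?mem_head.
  rewrite /weight => ->; rewrite !expr0.
  have := ler0n rat n; set s := \sum_(_ <- _) _; lra.
pose low := [seq n <- ns | (scale n <= g)%N].
pose high := [seq n <- ns | ~~ (scale n <= g)%N].
have permLH : perm_eq (low ++ high) ns by rewrite perm_filterC.
have [|e1 sp1 le1] := IH low; first by move=> m; rewrite mem_filter => /andP[].
set h := (2 ^ g.+1)%N.
have h0 : (0 < h)%N by rewrite expn_gt0.
have hE : 2 ^+ g.+1 = h%:R :> rat by rewrite natrX.
have hE' : 2 ^+ g = h%:R / 2 :> rat by rewrite -hE exprS; field.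
have hp : 0 < h%:R :> rat by rewrite ltr0n.
have -> : \sum_(n <- ns) weight g.+1 n =
   \sum_(n <- low) weight g.+1 n + \sum_(n <- high) weight g.+1 n.
  by rewrite -big_cat; apply/perm_big; rewrite perm_sym.
(* Passing from [weight g] to [weight g.+1] frees [n / h] per low length, exactly its share in the
   cost of the merge. *)
have -> : \sum_(n <- low) weight g.+1 n = \sum_(n <- low) weight g n + (sumn low)%:R / h%:R.
  elim: (low) => [|n l IHl]; first by rewrite !big_nil mul0r addr0.
  rewrite !big_cons IHl /= natrD /weight hE hE'.
  by set u := 4 / _; field; rewrite pnatr_eq0 -lt0n.
(* Three times [n / h] per high length: for the split, for the merge and for the overhead of
   both. *)
have high_ge : 3 * ((sumn high)%:R / h%:R) <= \sum_(n <- high) weight g.+1 n.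
  have : all (fun n => scale n == g.+1) high.
    apply/allP => m; rewrite mem_filter -ltnNge => /andP[lt_gn m_ns].
    by rewrite eqn_leq lt_gn le_g.
  elim: (high) => [|m l IHl]; first by rewrite big_nil mul0r mulr0.
  move=> /= /andP[/eqP scn al]; have lel := IHl al.
  rewrite big_cons /= natrD {1}/weight scn hE.
  have -> : 4 / h%:R - 1 / h%:R = 3 / h%:R :> rat by field; rewrite pnatr_eq0 -lt0n.
  have := ler0n rat (C 1); 
  have -> : 3 * ((m%:R + (sumn l)%:R) / h%:R) =
    m%:R * (3 / h%:R) + 3 * ((sumn l)%:R / h%:R) :> rat by ring.
  by lra.
(* Without high lengths no merge is made, as nothing could pay for its overhead. *)
have [highE|high_neq0] := eqVneq high [::].
  exists e1; first by apply: split_perm sp1; rewrite -(cats0 low) -highE.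
  apply: le_trans le1 _; rewrite lerD2l highE big_nil addr0 lerDl.
  by rewrite divr_ge0.
(* The split of [high] contributes [size high + 1] and the merge of two totals contributes 3. As
   [high] is nonempty, the sum is at most [5 * size high], which is the 5 in [threshold]. *)
have card_high : (C h * (size high + 4) <= sumn high %/ h)%N.
  rewrite leq_divRL //.
  have : all (fun n => (h * (5 * C h) <= n)%N) high.
    apply/allP => m; rewrite mem_filter -ltnNge => /andP[lt_gn m_ns].
    have := threshold_scale m.
    by have -> : scale m = g.+1 by apply/eqP; rewrite eqn_leq lt_gn le_g.
  move=> all_ge; apply: (@leq_trans (h * (5 * C h) * size high)%N).
    have : (0 < size high)%N by rewrite lt0n size_eq0.
    by move: (C h) (size high) => c m m0; rewrite mulnC -mulnA leq_mul2l; apply/orP; right; nia.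
  elim: (high) all_ge => [|m l IHl /= /andP[len /IHl lel]]; first by rewrite muln0.
  by rewrite mulnS leq_add.
have le_high := natr_divn_le (sumn high) h0.
have le_all := natr_divn_le (sumn low + sumn high)%N h0.
have := splitH [:: sumn low; sumn high] h0; rewrite /= addn0 => sp0.
have := split_cat sp0 sp1 (splitH high h0) => /(split_perm permLH) spl.
eexists; first exact: spl.
rewrite -(ler_nat rat) in card_high.
move: le_high le_all card_high; rewrite !(natrD, natrM) -(addn1 (size high)) !natrD.
rewrite mulrDl.
lra.
Qed.

Lemma split_sublinear : exists2 k : nat -> nat, sublinear R k &
  forall ns, ns != [::] -> split ns (\sum_(n <- ns) k n)%N.
Proof.
(* One [C 1] is that of [weight], the other lets a single segment pay the constant term of
   [split_scale], and 1 covers rounding. *)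
pose k n := ((C 1).*2 + 1 + (4 * n) %/ 2 ^ scale n)%N.
exists k; last first.
  move=> ns ns0.
  have [e sp le_e] := @split_scale (\max_(n <- ns) scale n) ns (fun n nns => @leq_bigmax_seq _ ns xpredT scale n nns isT).
  apply: split_mono sp; rewrite -(ler_nat rat); apply: le_trans le_e _.
  set g := \max_(_ <- _) _.
  have weight_k n : (C 1)%:R + weight g n <= (k n)%:R.
    rewrite /weight /k !natrD -addnn natrD.
    have := divn_eq (4 * n) (2 ^ scale n).
    have : (4 * n %% 2 ^ scale n < 2 ^ scale n)%N by rewrite ltn_mod expn_gt0.
    move=> lt_mod eq_div.
    have : n%:R * (4 / 2 ^+ scale n) <= ((4 * n) %/ 2 ^ scale n)%:R + 1 :> rat.
      rewrite mulrA ler_pdivrMr ?exprn_gt0 //.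
      rewrite -[X in _ <= (_ + X) * _]/(1%:R) -natrX -natrD -!natrM ler_nat mulnC {1}eq_div.
      by rewrite mulnDl mul1n leq_add2l ltnW.
    have : 0 <= n%:R * (1 / 2 ^+ g) :> rat.
      by rewrite mulr_ge0 // divr_ge0 // exprn_ge0.
    rewrite mulrBr; lra.
  case: ns ns0 @g weight_k => // n ns _ g weight_k.
  rewrite !big_cons natrD addrA lerD // natr_sum ler_sum // => m _.
  by apply: le_trans (weight_k m); rewrite lerDr.
rewrite /sublinear; apply/cvgr0Pnorm_lt => eps eps0.
pose K : R := ((C 1).*2 + 1)%:R.
(* Half of [eps * n] is reserved for the constant [K]; the other half must bound
   [4 * n / 2 ^ scale n], hence the 8. *)
have [g gP] : exists g : nat, 8 / eps < 2 ^+ g.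
  have [g gP] : exists g : nat, 8 / eps < g%:R.
    by exists (Num.bound (8 / eps)); apply: archi_boundP; rewrite divr_ge0 // ltW.
  by exists g; apply: lt_trans gP _; rewrite -natrX ltr_nat ltn_expl.
exists (maxn (maxn g (threshold g)) (Num.bound (2 * K / eps))) => // n /=.
rewrite geq_max => /andP[/scale_ge le_gs le_bn].
have K0 : 0 < K by rewrite ltr0n addn1.
have ltn : 2 * K / eps < n%:R.
  apply: (@lt_le_trans _ _ (Num.bound (2 * K / eps))%:R); last by rewrite ler_nat.
  by apply: archi_boundP; rewrite divr_ge0 ?mulr_ge0 ?ltW.
have n0 : 0 < n%:R :> R by apply: le_lt_trans ltn; rewrite divr_ge0 ?mulr_ge0 ?ltW.
rewrite ger0_norm ?divr_ge0 // ltr_pdivrMr // /k natrD -/K.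
have lt1 : K < eps * n%:R / 2.
  by rewrite ltr_pdivrMr // ltr_pdivlMr // mulrC in ltn *; lra.
suff : ((4 * n) %/ 2 ^ scale n)%:R <= eps * n%:R / 2 :> R by lra.
have two_s0 : 0 < 2 ^+ scale n :> R by rewrite exprn_gt0.
apply: (@le_trans _ _ (4 * n%:R / 2 ^+ scale n)).
  by rewrite ler_pdivlMr // -natrX -!natrM ler_nat leq_divM.
rewrite ler_pdivrMr //.
have : 8 / eps <= 2 ^+ scale n.
  by apply: le_trans (ltW gP) _; rewrite ler_weXn2l // ler1n.
rewrite ler_pdivrMr // => h8.
have : 0 <= (2 ^+ scale n * eps - 8) * n%:R by rewrite mulr_ge0 // subr_ge0.
by lra.
Qed.

End Diagonal.

(** * The semiring of tensors *)

Section Equivalence.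
Variable F : fieldType.
Implicit Types s t u : tensor F.

Definition tensor_eqv s t := tensor_le s t /\ tensor_le t s.

Lemma tensor_eqv_sym s t : tensor_eqv s t -> tensor_eqv t s.
Proof. by case. Qed.

Lemma tensor_eqv_refl s : tensor_eqv s s.
Proof. by split; apply: tensor_le_refl. Qed.

Lemma tensor_eqv_trans s t u : tensor_eqv s t -> tensor_eqv t u -> tensor_eqv s u.
Proof.
move=> [h1 h1'] [h2 h2']; split; first exact: tensor_le_trans h2 h1.
exact: tensor_le_trans h1' h2'.
Qed.

Lemma tensor_eqv_kron s s' t t' :
  tensor_eqv s s' -> tensor_eqv t t' -> tensor_eqv (kron s t) (kron s' t').
Proof. by move=> [? ?] [? ?]; split; apply: tensor_le_kron. Qed.

Lemma kronA s t u : tensor_eqv (kron s (kron t u)) (kron (kron s t) u).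
Proof.
pose f (x y z : finType) (q : x * (y * z)) := ((q.1, q.2.1), q.2.2).
pose g (x y z : finType) (q : x * y * z) := (q.1.1, (q.1.2, q.2)).
split.
  by apply: (@tensor_le_reindex _ (kron s (kron t u)) (kron (kron s t) u)
    (@f _ _ _) (@f _ _ _) (@f _ _ _)) => q; rewrite !ffunE /= mulrA.
by apply: (@tensor_le_reindex _ (kron (kron s t) u) (kron s (kron t u))
    (@g _ _ _) (@g _ _ _) (@g _ _ _)) => q; rewrite !ffunE /= mulrA.
Qed.

Lemma kronC_le s t : tensor_le (kron s t) (kron t s).
Proof.
pose f (x y : finType) (q : x * y) := (q.2, q.1).
by apply: (@tensor_le_reindex _ (kron s t) (kron t s)
    (@f _ _) (@f _ _) (@f _ _)) => q; rewrite !ffunE /= mulrC.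
Qed.

Lemma kronC s t : tensor_eqv (kron s t) (kron t s).
Proof. by split; apply: kronC_le. Qed.

Lemma unit_tensor1E q : tval (unit_tensor F 1) q = 1.
Proof.
case: q => [[x y] z]; rewrite /= sum_ffunE big_ord1 !ffunE /= !ord1 eqxx.
by rewrite !mulr1.
Qed.

Lemma kron1 s : tensor_eqv (kron (unit_tensor F 1) s) s.
Proof.
split.
  apply: (@tensor_le_reindex _ (kron (unit_tensor F 1) s) s snd snd snd) => q.
  by rewrite ffunE unit_tensor1E mul1r.
apply: (@tensor_le_reindex _ s (kron (unit_tensor F 1) s) (pair ord0) (pair ord0) (pair ord0)) => q.
by rewrite ffunE unit_tensor1E mul1r; case: q => [[]].
Qed.

Lemma kron_seq_cat (ts us : seq (tensor F)) :
  tensor_eqv (kron_seq (ts ++ us)) (kron (kron_seq ts) (kron_seq us)).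
Proof.
elim: ts => [|t ts IH] /=; first exact/tensor_eqv_sym/kron1.
apply: tensor_eqv_trans (kronA _ _ _).
exact: tensor_eqv_kron (tensor_eqv_refl t) IH.
Qed.

(** [catCA_perm_ind] reduces a permutation to exchanges of two adjacent initial blocks, where
    [kronC] applies. *)
Lemma kron_seq_perm (a : nat -> tensor F) ns ns' : perm_eq ns ns' ->
  tensor_eqv (kron_seq (map a ns)) (kron_seq (map a ns')).
Proof.
move=> p; move: (tensor_eqv_refl (kron_seq (map a ns))).
apply: (catCA_perm_ind (P := fun l => tensor_eqv (kron_seq (map a ns)) (kron_seq (map a l)))) p.
move=> l1 l2 l3 /tensor_eqv_trans; apply.
rewrite !map_cat !catA; apply: tensor_eqv_trans (kron_seq_cat _ _) _.
apply/tensor_eqv_sym/(tensor_eqv_trans (kron_seq_cat _ _)).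
apply: tensor_eqv_kron (tensor_eqv_refl _).
apply: tensor_eqv_trans (kron_seq_cat _ _) _.
apply: tensor_eqv_trans (kronC _ _) _.
exact/tensor_eqv_sym/kron_seq_cat.
Qed.

Lemma sum_le_pieces (X Y Z D : finType) (t : D -> tens F X Y Z) (s : tensor F) :
  (forall d, tensor_le (Tensor (t d)) s) -> sum_le #|D| (Tensor (\sum_d t d)) s.
Proof.
move=> le_ts.
have /boolp.choice[K KP] : forall d, exists K : (ix1 s -> X -> F) * (ix2 s -> Y -> F) * (ix3 s -> Z -> F),
   forall q, t d q = ker_app K.1.1 K.1.2 K.2 (tval s) q.
  by move=> d; have /tensor_leP[K1 [K2 [K3 KP]]] := le_ts d; exists (K1, K2, K3).
apply: (@sum_le_of_fin F D (Tensor (\sum_d t d)) s (fun d => (K d).1.1) (fun d => (K d).1.2) (fun d => (K d).2)) => q /=.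
by rewrite sum_ffunE; apply: eq_bigr => d _; rewrite KP.
Qed.

End Equivalence.

(** * Sums of blocks of tensor powers *)

Section BlockSums.
Variables (F : fieldType) (X Y Z A B C : finType).
Local Notation T := (A * B * C)%type.
Variables (EA : A -> X -> X -> F) (EB : B -> Y -> Y -> F) (EC : C -> Z -> Z -> F).
Variables (tau : T -> tens F X Y Z) (Phi : {set T}).
Hypothesis projE : forall (p p' : T) q,
  ker_app (EA p'.1.1) (EB p'.1.2) (EC p'.2) (tau p) q = (p == p')%:R * tau p q.

(** [unzip3] over an arbitrary index type, because the positions of a segment form a subtype and not
    an ordinal. *)
Definition ffun_unzip (X' Y' Z' I : finType) (f : {ffun I -> X' * Y' * Z'}) :
    {ffun I -> X'} * {ffun I -> Y'} * {ffun I -> Z'} :=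
  ([ffun l => (f l).1.1], [ffun l => (f l).1.2], [ffun l => (f l).2]).

Definition ffun_zip (X' Y' Z' I : finType) (q : {ffun I -> X'} * {ffun I -> Y'} * {ffun I -> Z'}) :
    {ffun I -> X' * Y' * Z'} := [ffun l => (q.1.1 l, q.1.2 l, q.2 l)].

Arguments ffun_unzip : simpl never.

Lemma ffun_unzipK (X' Y' Z' I : finType) : cancel (@ffun_unzip X' Y' Z' I) (@ffun_zip X' Y' Z' I).
Proof. by move=> f; apply/ffunP => l; rewrite !ffunE; case: (f l) => [[]]. Qed.

Lemma ffun_zipK (X' Y' Z' I : finType) : cancel (@ffun_zip X' Y' Z' I) (@ffun_unzip X' Y' Z' I).
Proof.
by move=> [[x y] z]; congr (_, _, _); apply/ffunP => l; rewrite !ffunE.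
Qed.

(** Distributivity: a product of sums over letters is a sum over strings. *)
Lemma ker_app_prod (I X1 Y1 Z1 X2 Y2 Z2 : finType) (K1 : I -> X1 -> X2 -> F) (K2 : I -> Y1 -> Y2 -> F)
    (K3 : I -> Z1 -> Z2 -> F) (t : I -> X1 * Y1 * Z1 -> F)
    (q : {ffun I -> X2} * {ffun I -> Y2} * {ffun I -> Z2}) :
  ker_app (fun (x : {ffun I -> X1}) (x' : {ffun I -> X2}) => \prod_l K1 l (x l) (x' l))
    (fun (y : {ffun I -> Y1}) (y' : {ffun I -> Y2}) => \prod_l K2 l (y l) (y' l))
    (fun (z : {ffun I -> Z1}) (z' : {ffun I -> Z2}) => \prod_l K3 l (z l) (z' l))
    (fun q => \prod_l t l (q.1.1 l, q.1.2 l, q.2 l)) q =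
  \prod_l ker_app (K1 l) (K2 l) (K3 l) (t l) (q.1.1 l, q.1.2 l, q.2 l).
Proof.
rewrite /ker_app bigA_distr_bigA /= (reindex (@ffun_unzip X1 Y1 Z1 I)) /=; last first.
  by exists (@ffun_zip X1 Y1 Z1 I) => ? _; rewrite (ffun_unzipK, ffun_zipK).
apply: eq_bigr => f _; rewrite -!big_split /=; apply: eq_bigr => l _.
by rewrite !ffunE -!surjective_pairing.
Qed.

(* If [tau p] is the block [t_p], this is [t^(x)I[D]]. *)
Definition bsum_val (I : finType) (D : {set {ffun I -> T}}) :
    tens F {ffun I -> X} {ffun I -> Y} {ffun I -> Z} :=
  [ffun q : {ffun I -> X} * {ffun I -> Y} * {ffun I -> Z} =>
    \sum_(s in D) \prod_l tau (s l) (q.1.1 l, q.1.2 l, q.2 l)].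

Definition bsum (I : finType) (D : {set {ffun I -> T}}) : tensor F := Tensor (bsum_val D).

Definition mixes (I : finType) (s s1 s2 s3 : {ffun I -> T}) :=
  forall l, s l = ((s1 l).1.1, (s2 l).1.2, (s3 l).2).

(* Among the strings over [Phi], [D] is cut out by separate conditions on the
   [A]-, [B]- and [C]-components. *)
Definition rect (I : finType) (D : {set {ffun I -> T}}) :=
  forall s s1 s2 s3 : {ffun I -> T}, (forall l, s l \in Phi) -> s1 \in D -> s2 \in D -> s3 \in D ->
    mixes s s1 s2 s3 -> s \in D.

(** On each leg, project onto the sum of the summands whose labels occur as components of strings in
    [D']. The surviving strings of [D] have all three components from [D'], so [rect] puts them in
    [D']. *)
Lemma bsum_rect (I : finType) (D' D : {set {ffun I -> T}}) :
    D' \subset D -> (forall (s : {ffun I -> T}) l, s \in D -> s l \in Phi) -> rect D' ->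
  tensor_le (bsum D') (bsum D).
Proof.
move=> sD'D DPhi rectD'.
pose DA := [set (ffun_unzip s).1.1 | s in D'].
pose DB := [set (ffun_unzip s).1.2 | s in D'].
pose DC := [set (ffun_unzip s).2 | s in D'].
pose KA (i : {ffun I -> A}) (x x' : {ffun I -> X}) := \prod_l EA (i l) (x l) (x' l).
pose KB (i : {ffun I -> B}) (x x' : {ffun I -> Y}) := \prod_l EB (i l) (x l) (x' l).
pose KC (i : {ffun I -> C}) (x x' : {ffun I -> Z}) := \prod_l EC (i l) (x l) (x' l).
apply/tensor_leP.
exists (fun x x' => \sum_i (i \in DA)%:R * KA i x x').
exists (fun x x' => \sum_i (i \in DB)%:R * KB i x x').
exists (fun x x' => \sum_i (i \in DC)%:R * KC i x x') => q.
pose ind (i : {ffun I -> T}) : F :=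
  ((ffun_unzip i).1.1 \in DA)%:R * ((ffun_unzip i).1.2 \in DB)%:R * ((ffun_unzip i).2 \in DC)%:R.
(* The product of the three kernel sums runs over triples of component strings, that is, over
   strings [i] of triples. *)
transitivity (\sum_i ind i * \sum_(s in D) ker_app (KA (ffun_unzip i).1.1) (KB (ffun_unzip i).1.2)
   (KC (ffun_unzip i).2) (fun q => \prod_l tau (s l) (q.1.1 l, q.1.2 l, q.2 l)) q); last first.
  rewrite [RHS]/ker_app.
  under [RHS]eq_bigr => q0 _ do rewrite !sum_mul mulr_sumr.
  rewrite [RHS]exchange_big (reindex (@ffun_zip A B C I)); last first.
    by exists (@ffun_unzip A B C I) => ? _; rewrite (ffun_unzipK, ffun_zipK).
  apply: eq_bigr => i _; rewrite /ind ffun_zipK /=.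
  rewrite exchange_big mulr_sumr /=; apply: eq_bigr => q0 _.
  rewrite -mulr_suml ffunE /=; set S := \sum_(s in D) _; ring.
have E (s i : {ffun I -> T}) : ker_app (KA (ffun_unzip i).1.1) (KB (ffun_unzip i).1.2)
   (KC (ffun_unzip i).2) (fun q => \prod_l tau (s l) (q.1.1 l, q.1.2 l, q.2 l)) q =
   (s == i)%:R * \prod_l tau (s l) (q.1.1 l, q.1.2 l, q.2 l).
  rewrite (ker_app_prod (fun l => EA ((ffun_unzip i).1.1 l)) (fun l => EB ((ffun_unzip i).1.2 l))
    (fun l => EC ((ffun_unzip i).2 l)) (fun l => tau (s l))).
  rewrite [LHS](eq_bigr (fun l => (s l == i l)%:R * tau (s l) (q.1.1 l, q.1.2 l, q.2 l))); last first.
    by move=> l _; rewrite /ffun_unzip !ffunE projE.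
  by rewrite big_split prod_eq_ffun.
rewrite /= ffunE.
under [RHS]eq_bigr => i _ do rewrite mulr_sumr.
rewrite exchange_big /= [RHS](bigID (mem D')) /= [X in _ = _ + X]big1 ?addr0 => [|s /andP[sD nsD']].
  rewrite (eq_bigl (fun s => (s \in D) && (s \in D'))) => [|s]; last first.
    by case: (boolP (s \in D')) => [/(fintype.subsetP sD'D) ->|]; rewrite ?andbF.
  apply: eq_bigr => s /andP[sD sD'].
  rewrite [RHS](bigD1 s) //= [X in _ = _ + X]big1 ?addr0 => [|i nis].
    rewrite E eqxx /ind mul1r (_ : _ \in DA); last exact: (imset_f (fun s => (ffun_unzip s).1.1)).
    rewrite (_ : _ \in DB); last exact: (imset_f (fun s => (ffun_unzip s).1.2)).
    rewrite (_ : _ \in DC); last exact: (imset_f (fun s => (ffun_unzip s).2)).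
    by rewrite !mul1r.
  by rewrite E eq_sym (negPf nis) mul0r mulr0.
(* A term from outside [D'] that survived would be a mix of strings of [D']. *)
rewrite big1 // => i _; rewrite E; case: (s =P i) => [<-|]; last by rewrite mul0r mulr0.
rewrite /ind -!natrM !mulnb; case: (boolP (_ && _ && _)) => [|_]; last by rewrite !mul0r.
case/andP => /andP[/imsetP[s1 s1D e1] /imsetP[s2 s2D e2]] /imsetP[s3 s3D e3].
case/negP: nsD'; apply: (rectD' s s1 s2 s3) => // [l|l]; first exact: DPhi.
move: e1 e2 e3 => /= /ffunP/(_ l) + /ffunP/(_ l) + /ffunP/(_ l); rewrite !ffunE => <- <- <-.
by case: (s l) => [[]].
Qed.

(** Cutting strings along [h] is a bijection onto pairs of strings, so the two sides differ by a
    reindexing only. *)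
Lemma bsum_kron (I0 I1 I : finType) (h : I0 + I1 -> I) (D0 : {set {ffun I0 -> T}})
    (D1 : {set {ffun I1 -> T}}) (D : {set {ffun I -> T}}) :
    bijective h ->
    (forall s : {ffun I -> T}, (s \in D) =
       ([ffun i => s (h (inl i))] \in D0) && ([ffun i => s (h (inr i))] \in D1)) ->
  tensor_eqv (bsum D) (kron (bsum D0) (bsum D1)).
Proof.
move=> [h' hK h'K] DE.
pose sp (S : finType) (s : {ffun I -> S}) : {ffun I0 -> S} * {ffun I1 -> S} :=
  ([ffun i => s (h (inl i))], [ffun i => s (h (inr i))]).
pose gl (S : finType) (s : {ffun I0 -> S} * {ffun I1 -> S}) : {ffun I -> S} :=
  [ffun l => match h' l with inl i => s.1 i | inr i => s.2 i end].
have glK (S : finType) : cancel (@gl S) (@sp S).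
  by move=> [s0 s1]; congr pair; apply/ffunP => i; rewrite !ffunE hK.
have spK (S : finType) : cancel (@sp S) (@gl S).
  move=> s; apply/ffunP => l; rewrite ffunE.
  by case e: (h' l) => [i|i]; rewrite ffunE -e h'K.
have valE q : bsum_val D q = tval (kron (bsum D0) (bsum D1)) (sp _ q.1.1, sp _ q.1.2, sp _ q.2).
  rewrite [RHS]ffunE /= !ffunE /= mulr_suml.
  under [RHS]eq_bigr => s0 _ do rewrite mulr_sumr.
  rewrite pair_big /= (reindex (@gl T)) /=; last by exists (@sp T) => ? _; rewrite (spK, glK).
  apply: eq_big => [s|s _].
    rewrite DE; have := glK _ s; case: s => s0 s1 /= [-> ->]; by [].
  rewrite (reindex h) /=; last by exists h' => ? _; rewrite (hK, h'K).
  rewrite big_sumType /=; congr (_ * _); apply: eq_bigr => i _; by rewrite !ffunE hK.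
split.
  by apply: (@tensor_le_reindex _ (bsum D) (kron (bsum D0) (bsum D1)) (sp X) (sp Y) (sp Z)) => q; rewrite -valE.
apply: (@tensor_le_reindex _ (kron (bsum D0) (bsum D1)) (bsum D) (gl X) (gl Y) (gl Z)) => q.
by case: q => [[x y] z]; rewrite [tval (bsum D)]/= valE !glK.
Qed.

End BlockSums.

(** * Further counting and an exponential bound *)

Section MoreCounting.
Local Open Scope nat_scope.

Lemma card_inj_preim (I' I : finType) (f : I' -> I) (P : pred I) : injective f ->
  (forall l, P l -> exists i, l = f i) -> #|[set i | P (f i)]| = #|[set l | P l]|.
Proof.
move=> f_inj P_im; rewrite -(card_imset _ f_inj); apply: eq_card => l.
apply/imsetP/idP => [[i + ->]|]; rewrite !inE // => Pl.
by have [i li] := P_im l Pl; exists i; rewrite // inE -li.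
Qed.

Lemma card_divn_fiber (M L c : nat) : 0 < L -> #|[set l : 'I_M | l %/ L == c]| <= L.
Proof.
move=> L0; pose f (l : 'I_M) : 'I_L := Ordinal (ltn_pmod l L0).
rewrite -[X in _ <= X]card_ord -(card_in_imset (f := f)) ?max_card //.
move=> l l'; rewrite !inE => /eqP lc /eqP l'c [eq_mod]; apply: val_inj => /=.
by rewrite (divn_eq l L) (divn_eq l' L) lc l'c eq_mod.
Qed.

(** Serves to choose the piece length [2 ^ m]. With [m = 2 j] and [j = c + 3], both [c] and
    [2 j + 1] are at most [2 ^ j]. *)
Lemma exists_pow_bound (c : nat) : exists m, c * m.+1 <= 2 ^ m.
Proof.
have le j : 3 <= j -> j.*2.+1 <= 2 ^ j.
  elim: j => // j IH; rewrite ltnS leq_eqVlt => /orP[/eqP <- //|lt_j].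
  by have := IH lt_j; rewrite expnS -!addnn; lia.
exists (c + 3).*2; rewrite -addnn expnD leq_mul //.
  by apply: leq_trans (ltnW (ltn_expl _ (isT : 1 < 2))) _; rewrite leq_exp2l ?leq_addr.
by rewrite addnn le // leq_addl.
Qed.

Lemma distribute_all (J : finType) (ds : seq nat) : sumn ds = #|J| ->
  exists2 g : J -> nat, (forall y, g y < size ds) &
    forall j, j < size ds -> #|[set y | g y == j]| = nth 0 ds j.
Proof.
move=> sum_ds; have [|g gP] := @distribute J [set: J] ds; first by rewrite sum_ds cardsT.
have gE j : j < size ds -> #|[set y | g y == j]| = nth 0 ds j.
  by move=> lt_j; rewrite -gP //; apply: eq_card => y; rewrite !inE.
exists g => // y; have := card_values predT g (size ds).
rewrite (eq_bigr (fun j : 'I_(size ds) => nth 0 ds j)) => [|j _]; last by rewrite -gE.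
have -> : #|[set y : J | predT y]| = sumn ds by rewrite sum_ds; apply: eq_card => z; rewrite !inE.
rewrite [in LHS]sumnE (big_nth 0) big_mkord.
move/eqP; rewrite -{1}[X in X == _]addn0 eqn_add2l eq_sym cards_eq0 => /eqP/finset.setP/(_ y).
by rewrite !inE /= leqNgt => /negbFE.
Qed.

End MoreCounting.

(** * Type classes *)

Section TypeClasses.
Variables (F : fieldType) (X Y Z A B C : finType).
Local Notation T := (A * B * C)%type.
Variables (EA : A -> X -> X -> F) (EB : B -> Y -> Y -> F) (EC : C -> Z -> Z -> F).
Variables (tau : T -> tens F X Y Z) (Phi : {set T}).
Hypothesis projE : forall (p p' : T) q,
  ker_app (EA p'.1.1) (EB p'.1.2) (EC p'.2) (tau p) q = (p == p')%:R * tau p q.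
Hypothesis count_inj : forall q q' : T -> nat,
  (forall x, x \notin Phi -> q x = 0%N) -> (forall x, x \notin Phi -> q' x = 0%N) ->
  (forall a, \sum_(x | x.1.1 == a) q x = \sum_(x | x.1.1 == a) q' x)%N ->
  (forall b, \sum_(x | x.1.2 == b) q x = \sum_(x | x.1.2 == b) q' x)%N ->
  (forall c, \sum_(x | x.2 == c) q x = \sum_(x | x.2 == c) q' x)%N -> q =1 q'.
Variables (p : T -> nat) (k : nat).
Hypothesis sum_p : (\sum_x p x = k)%N.
Hypothesis k_gt0 : (0 < k)%N.
Hypothesis p_supp : forall x, x \notin Phi -> p x = 0%N.

Local Notation bsum := (bsum tau).

(** With [p x = k P(x)] and [#|I| = n k] this is the type class of [P], over any set of
    positions. *)
Definition typeset (I : finType) (n : nat) : {set {ffun I -> T}} :=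
  [set s : {ffun I -> T} | [forall x, #|[set l | s l == x]| == n * p x]%N].

Definition segset (I : finType) (g : I -> nat) (ns : seq nat) : {set {ffun I -> T}} :=
  [set s : {ffun I -> T} | [forall j : 'I_(size ns), [forall x,
     #|[set l | (g l == j) && (s l == x)]| == nth 0 ns j * p x]]%N].

Definition aseq (n : nat) : tensor F := bsum (typeset 'I_(n * k) n).

Lemma typesetP (I : finType) n (s : {ffun I -> T}) :
  reflect (forall x, #|[set l | s l == x]| = n * p x)%N (s \in typeset I n).
Proof.
by rewrite inE; apply: (iffP forallP) => h x; apply/eqP; rewrite h.
Qed.

Lemma segsetP (I : finType) (g : I -> nat) ns (s : {ffun I -> T}) :
  reflect (good p ns g s) (s \in segset g ns).
Proof.
rewrite inE; apply: (iffP forallP) => [h j x lt_j|h j].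
  by apply/eqP; apply: (forallP (h (Ordinal lt_j))).
by apply/forallP => x; rewrite h.
Qed.

Lemma typeset_Phi (I : finType) n (s : {ffun I -> T}) l : s \in typeset I n -> s l \in Phi.
Proof.
move/typesetP/(_ (s l)) => card_s; apply/contraT => /p_supp p0.
move: card_s; rewrite p0 muln0 => /eqP; rewrite cards_eq0 => /eqP/setP/(_ l).
by rewrite !inE eqxx.
Qed.

(** The counts of [s] on [P] have the marginals of [n], one from each of [s1], [s2], [s3], so
    [count_inj] applies. An arbitrary [P] covers whole strings, segments and pieces alike. *)
Lemma mix_count (I : finType) (P : pred I) (n : T -> nat) (s s1 s2 s3 : {ffun I -> T}) :
    (forall l, s l \in Phi) -> (forall l, s1 l \in Phi) -> mixes s s1 s2 s3 ->
    (forall x, #|[set l | P l && (s1 l == x)]| = n x) ->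
    (forall x, #|[set l | P l && (s2 l == x)]| = n x) ->
    (forall x, #|[set l | P l && (s3 l == x)]| = n x) ->
  forall x, #|[set l | P l && (s l == x)]| = n x.
Proof.
move=> sPhi s1Phi mix n1 n2 n3.
have supp0 (s' : {ffun I -> T}) : (forall l, s' l \in Phi) ->
    forall x, x \notin Phi -> #|[set l | P l && (s' l == x)]| = 0%N.
  move=> s'Phi x; apply: contraNeq; rewrite -lt0n => /card_gt0P[l].
  by rewrite inE => /andP[_ /eqP <-].
have marg (V : eqType) (f : T -> V) (s' : {ffun I -> T}) v :
    (\sum_(x | f x == v) #|[set l | P l && (s' l == x)]| = #|[set l | (f (s' l) == v) && P l]|)%N.
  rewrite (card_fibers s' (fun x => f x == v)); apply: eq_bigr => x _.
  by apply: eq_card => l; rewrite !inE andbC.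
have eq_marg (V : eqType) (f : T -> V) (s' : {ffun I -> T}) v :
    (forall l, f (s l) = f (s' l)) -> (forall x, #|[set l | P l && (s' l == x)]| = n x) ->
    (\sum_(x | f x == v) #|[set l | P l && (s l == x)]| = \sum_(x | f x == v) n x)%N.
  move=> eq_f n'; rewrite marg.
  rewrite [RHS](eq_bigr (fun x => #|[set l | P l && (s' l == x)]|)) => [|x _]; last by rewrite n'.
  by rewrite marg; apply: eq_card => l; rewrite !inE eq_f.
apply: count_inj => [|x /(supp0 s1 s1Phi)|a|b|c]; first exact: supp0.
- by rewrite n1.
- by apply: (eq_marg _ (fun x => x.1.1) s1) => // l; rewrite mix.
- by apply: (eq_marg _ (fun x => x.1.2) s2) => // l; rewrite mix.
- by apply: (eq_marg _ (fun x => x.2) s3) => // l; rewrite mix.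
Qed.

Lemma rect_typeset (I : finType) n : rect Phi (typeset I n).
Proof.
move=> s s1 s2 s3 sPhi s1n s2n s3n mix; apply/typesetP.
by apply: (@mix_count I predT (fun x => n * p x)%N s s1 s2 s3) => //;
   [move=> l; apply: typeset_Phi s1n | apply/typesetP | apply/typesetP | apply/typesetP].
Qed.

Lemma segset_sub (I : finType) (g : I -> nat) ns : (forall l, g l < size ns)%N ->
  segset g ns \subset typeset I (sumn ns).
Proof.
move=> lt_g; apply/fintype.subsetP => s /segsetP gs; apply/typesetP => x.
rewrite (card_values (fun l => s l == x) g (size ns)) [X in (_ + X)%N]eq_card0 => [|l]; last first.
  by rewrite !inE leqNgt lt_g andbF.
rewrite addn0 sumnE (big_nth 0%N) big_mkord big_distrl /=; apply: eq_bigr => j _.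
by rewrite -(gs _ x (ltn_ord j)); apply: eq_card => l; rewrite !inE andbC.
Qed.

Lemma rect_segset (I : finType) (g : I -> nat) ns : (forall l, g l < size ns)%N ->
  rect Phi (segset g ns).
Proof.
move=> lt_g s s1 s2 s3 sPhi s1n s2n s3n mix; apply/segsetP => j x lt_j.
have s1Phi l : s1 l \in Phi by apply: typeset_Phi (fintype.subsetP (segset_sub lt_g) _ s1n).
apply: (@mix_count I (fun l => g l == j) (fun x => nth 0 ns j * p x)%N s s1 s2 s3) => // y.
- by move/segsetP: s1n => ->.
- by move/segsetP: s2n => ->.
- by move/segsetP: s3n => ->.
Qed.

(** Induction on [ns]: the first segment is enumerated by an ordinal, and the other positions form a
    subtype on which [g] is lowered by one. *)
Lemma seg_kron (ns : seq nat) (I : finType) (g : I -> nat) :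
    (forall l, g l < size ns)%N ->
    (forall j, j < size ns -> #|[set l | g l == j]| = nth 0 ns j * k)%N ->
  tensor_eqv (bsum (segset g ns)) (kron_seq [seq aseq n | n <- ns]).
Proof.
elim: ns I g => [|n ns IH] I g lt_g card_g.
  (* With no segments there are no positions: the empty string alone remains, and the tensor is the
     unit. *)
  have I0 (l : I) : False by have := lt_g l.
  have val1 q : tval (bsum (segset g [::])) q = 1.
    rewrite /= ffunE (bigD1 [ffun l => False_rect T (I0 l)]) /=; last first.
      by apply/segsetP => j.
    rewrite big1 => [|l _]; last by case: (I0 l).
    rewrite big1 ?addr0 // => s /andP[_ /eqP[]]; apply/ffunP => l; by case: (I0 l).
  split.
    apply: (@tensor_le_reindex _ (bsum (segset g [::])) (unit_tensor F 1)
      (fun=> ord0) (fun=> ord0) (fun=> ord0)) => q.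
    by rewrite val1 unit_tensor1E.
  apply: (@tensor_le_reindex _ (unit_tensor F 1) (bsum (segset g [::]))
      (fun=> [ffun l => False_rect X (I0 l)]) (fun=> [ffun l => False_rect Y (I0 l)])
      (fun=> [ffun l => False_rect Z (I0 l)])) => q.
  by rewrite val1 unit_tensor1E.
pose I1 := {l : I | g l != 0%N}.
pose g1 (l : I1) := (g (val l)).-1.
have card0 : #|[set l | g l == 0%N]| = (n * k)%N by apply: (card_g 0%N).
pose h0 (i : 'I_(n * k)) : I := enum_val (cast_ord (esym card0) i).
have gh0 i : g (h0 i) = 0%N by have := enum_valP (cast_ord (esym card0) i); rewrite inE => /eqP.
have h0_inj : injective h0 by apply: inj_comp enum_val_inj (@cast_ord_inj _ _ _).
have h0_im l : g l == 0%N -> exists i, l = h0 i.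
  move=> gl0; have lI : l \in [set l | g l == 0%N] by rewrite inE.
  exists (cast_ord card0 (enum_rank_in lI l)).
  by rewrite /h0 cast_ordK enum_rankK_in.
pose h (i : 'I_(n * k) + I1) := match i with inl i => h0 i | inr i => val i end.
have h_inj : injective h.
  move=> [i|i] [j|j] /= e.
  - by rewrite (h0_inj _ _ e).
  - by have := valP j; rewrite /= -e gh0.
  - by have := valP i; rewrite /= e gh0.
  - by rewrite (val_inj e).
have h_bij : bijective h.
  apply: (inj_card_bij h_inj); rewrite card_sum card_ord card_sig -card0.
  rewrite -(cardC [pred l | g l == 0%N]) leq_add //.
 by apply: eq_leq; apply: eq_card => l; rewrite !inE.
have g1E (l : I1) : g (val l) = (g1 l).+1 by rewrite prednK // lt0n (valP l).
have [|j lt_j|h1 h1'] := IH I1 g1.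
- by move=> l; have := lt_g (val l); rewrite g1E.
- rewrite -(card_g j.+1) //.
  rewrite -(card_inj_preim (f := val : I1 -> I)) //; first by apply: eq_card => l; rewrite !inE g1E.
    exact: val_inj.
  move=> l gl; have gl0 : g l != 0%N by rewrite (eqP gl).
  by exists (Sub l gl0); rewrite SubK.
apply: tensor_eqv_trans (tensor_eqv_kron (tensor_eqv_refl _) (conj h1 h1')).
apply: (@bsum_kron F X Y Z A B C tau _ _ _ h _ _ _ h_bij) => s.
apply/segsetP/andP => [gs|[/typesetP s0 /segsetP s1] [|j] x lt_j].
  split.
    apply/typesetP => x; rewrite -(gs 0%N x) //.
    rewrite -(card_inj_preim (f := h0)) //; first by apply: eq_card => l; rewrite !inE ffunE gh0.
    by move=> l /andP[/h0_im].
  apply/segsetP => j x lt_j; rewrite -(gs j.+1 x) //.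
  rewrite -(card_inj_preim (f := val : I1 -> I)) //; first by apply: eq_card => l; rewrite !inE ffunE g1E.
    exact: val_inj.
  move=> l /andP[gl _]; have gl0 : g l != 0%N by rewrite (eqP gl).
  by exists (Sub l gl0); rewrite SubK.
  rewrite -s0 /= -(card_inj_preim (f := h0)) //; first by apply: eq_card => l; rewrite !inE ffunE gh0.
  by move=> l /andP[/h0_im].
rewrite -s1 //= -(card_inj_preim (f := val : I1 -> I)) //; first by apply: eq_card => l; rewrite !inE ffunE g1E.
  exact: val_inj.
move=> l /andP[gl _]; have gl0 : g l != 0%N by rewrite (eqP gl).
by exists (Sub l gl0); rewrite SubK.
Qed.

(** Any assignment with segments of sizes [n_j k] will do, since prescribing the type of every
    segment is a [rect] condition. *)
Lemma kron_seq_le_aseq ns : tensor_le (kron_seq [seq aseq n | n <- ns]) (aseq (sumn ns)).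
Proof.
have sumk : sumn [seq n * k | n <- ns]%N = (sumn ns * k)%N.
  by elim: ns => //= n ns ->; rewrite mulnDl.
have [|g lt_g card_g] := @distribute_all 'I_(sumn ns * k) [seq n * k | n <- ns]%N.
  by rewrite sumk card_ord.
rewrite size_map in lt_g card_g.
have {}card_g j : (j < size ns)%N -> #|[set l | g l == j]| = (nth 0 ns j * k)%N.
  by move=> lt_j; rewrite card_g // (nth_map 0%N).
apply: tensor_le_trans (seg_kron lt_g card_g).2.
apply: (bsum_rect projE (segset_sub lt_g)) (rect_segset lt_g).
by move=> s l; apply: typeset_Phi.
Qed.

(** The bound is the number of cells: [L + 1] counts for each piece and letter, and a letter or
    [None] in each slot for left over positions. *)
Lemma aseq_sum_le (m : nat) (ns : seq nat) (L := (2 ^ m)%N) :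
  sum_le (L.+1 ^ ((sumn ns * k %/ L).+1 * #|{: T}|) *
          #|{: T}|.+1 ^ (L * (size ns * L.+1 ^ #|{: T}|)))
    (aseq (sumn ns)) (kron_seq [seq aseq n | n <- ns]).
Proof.
set N := sumn ns; set M := (N * k)%N.
have L0 : (0 < L)%N by rewrite expn_gt0.
(* Pieces are intervals of length [L]; the additional one holds the remainder. *)
pose b (l : 'I_M) : 'I_(M %/ L).+1 := inord (l %/ L).
have bE l : b l = (l %/ L)%N :> nat.
  by rewrite inordK // ltnS leq_div2r // ltnW.
have b_small c : (#|[set l | b l == c]| <= L)%N.
  apply: leq_trans (card_divn_fiber M c L0); apply: subset_leq_card.
  by apply/fintype.subsetP => l; rewrite !inE => /eqP <-; rewrite bE.
have I_empty : N = 0%N -> #|'I_M| = 0%N by rewrite card_ord /M => ->.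
have [delta [rest [g [deltaP gP]]]] := @cells T p ns 'I_M _ L b b_small I_empty.
set q := (M %/ L).+1 in b bE b_small delta rest g deltaP gP *.
set rho := (L * _)%N in delta g deltaP gP.
set D := ({ffun 'I_q * T -> 'I_L.+1} * {ffun 'I_rho -> option T})%type in delta g deltaP gP.
have -> : (L.+1 ^ (q * #|{: T}|) * #|{: T}|.+1 ^ (L * (size ns * L.+1 ^ #|{: T}|)))%N = #|{: D}|.
  by rewrite /D /rho !(card_prod, card_ffun, card_option, card_ord).
pose Dd (d : D) := [set s in typeset 'I_M N | delta s == d].
have DdE d s : (s \in Dd d) = (s \in typeset 'I_M N) && (delta s == d) by rewrite [LHS]inE.
have -> : aseq N = Tensor (\sum_d bsum_val tau (Dd d)).
  congr Tensor; apply/ffunP => x; rewrite sum_ffunE ffunE.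
  rewrite (partition_big delta xpredT) //=; apply: eq_bigr => d _; rewrite ffunE.
  by apply: eq_bigl => s; rewrite DdE.
apply: sum_le_pieces => d.
(* An empty cell gives the zero tensor; in a nonempty one, a string determines the sizes of the
   segments. *)
have [[s0 s0d]|no_s] := pselect (exists s, s \in Dd d); last first.
  have -> : Dd d = finset.set0 by apply/finset.setP => s; rewrite [RHS]inE; apply/negP => sd; case: no_s; exists s.
  apply/tensor_leP; exists (fun _ _ => 0), (fun _ _ => 0), (fun _ _ => 0) => x.
  by rewrite ker_app0 ffunE big_set0.
have DdP s : s \in Dd d -> (forall l, g d l < size ns)%N /\ good p ns (g d) s.
  by rewrite DdE inE => /andP[sN /eqP <-]; apply: gP.
have [lt_g good0] := DdP s0 s0d.
have card_g j : (j < size ns)%N -> #|[set l | g d l == j]| = (nth 0 ns j * k)%N.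
  move=> lt_j; rewrite -sum_p big_distrr /=.
  rewrite (eq_bigr (fun x => #|[set l | (s0 l == x) && (g d l == j)]|)) => [|x _].
    by rewrite -(card_fibers s0 xpredT).
  by rewrite -good0 //; apply: eq_card => l; rewrite !inE andbC.
apply: tensor_le_trans (seg_kron lt_g card_g).1 _.
have DdPhi s l : s \in Dd d -> s l \in Phi by rewrite DdE => /andP[/typeset_Phi].
apply: (bsum_rect projE).
- by apply/fintype.subsetP => s /DdP[_ ?]; apply/segsetP.
- move=> s l sg; exact: typeset_Phi (fintype.subsetP (segset_sub lt_g) _ sg).
move=> s s1 s2 s3 sPhi s1d s2d s3d mix.
have s1Phi l : s1 l \in Phi by apply: DdPhi.
move: s1d s2d s3d; rewrite !DdE.
case/andP=> s1N /eqP e1 /andP[s2N /eqP e2] /andP[s3N /eqP e3].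
apply/andP; split.
  exact: rect_typeset mix.
(* The cell is [rect]: piece counts of the mixed string follow from [mix_count], and at left over
   positions the three strings agree. *)
rewrite -e1; apply/eqP/deltaP.
have [c12 r12] := (deltaP s1 s2).1 (etrans e1 (esym e2)).
have [c13 r13] := (deltaP s1 s3).1 (etrans e1 (esym e3)).
have cs : piece_count L b s = piece_count L b s1.
  apply/ffunP => -[c x]; apply: val_inj => /=; rewrite !piece_countE //.
  apply: (@mix_count _ (fun l => b l == c) (fun x => #|[set l | (b l == c) && (s1 l == x)]|) s s1 s2 s3) => // y.
    by rewrite -!(piece_countE b_small) c12.
  by rewrite -!(piece_countE b_small) c13.
split=> // l l_rest; rewrite cs in l_rest.
by rewrite mix -r12 // -r13 //; case: (s1 l) => [[]].
Qed.

(** A piece costs at most [(m + 1) #|T|] bits, as [L + 1 <= 2 ^ (m + 1)]. The choice of [m] makes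
    all [M / L] full pieces together cost at most [sumn ns / h]. *)
Lemma aseq_split (h : nat) : exists c, forall ns, (0 < h)%N ->
  sum_le (2 ^ (sumn ns %/ h + c * (size ns).+1))
    (aseq (sumn ns)) (kron_seq [seq aseq n | n <- ns]).
Proof.
have [m mP] := exists_pow_bound (#|{: T}| * k * h).
pose L := (2 ^ m)%N.
(* The first term pays for the last, incomplete piece, the second for the left over letters, by
   [#|T| + 1 <= 2 ^ #|T|]. *)
exists (m.+1 * #|{: T}| + #|{: T}| * (L * L.+1 ^ #|{: T}|))%N => ns h0.
apply: sum_le_widen (aseq_sum_le m ns).
rewrite -/L; set M := (sumn ns * k)%N.
apply: (@leq_trans (2 ^ (m.+1 * ((M %/ L).+1 * #|{: T}|)) *
    2 ^ (#|{: T}| * (L * (size ns * L.+1 ^ #|{: T}|))))).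
  have le_exp u v e : (u <= v -> u ^ e <= v ^ e)%N.
    by case: e => // e; rewrite leq_exp2r.
  apply: leq_mul; rewrite [X in (_ <= X)%N]expnM le_exp //.
  - by rewrite expnS mul2n -addnn -addn1 leq_add // expn_gt0.
  - exact: ltn_expl.
rewrite -expnD leq_exp2l //.
have le_pieces : (m.+1 * ((M %/ L) * #|{: T}|) <= sumn ns %/ h)%N.
  rewrite leq_divRL // -(leq_pmul2r k_gt0).
  apply: (@leq_trans (M %/ L * (#|{: T}| * k * h * m.+1))%N); last first.
    by apply: leq_trans (leq_mul (leqnn _) mP) _; apply: leq_divM.
  by apply: eq_leq; ring.
move: le_pieces; move: #|{: T}| (M %/ L)%N (size ns) (sumn ns %/ h)%N => t a r d le_pieces.
have -> : (m.+1 * (a.+1 * t) = m.+1 * (a * t) + m.+1 * t)%N by rewrite (mulSn a) mulnDr addnC.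
rewrite -addnA leq_add // mulnDl leq_add //; first by rewrite leq_pmulr.
have -> : (t * (L * L.+1 ^ t) * r.+1 = t * (L * (r.+1 * L.+1 ^ t)))%N.
  by rewrite -!mulnA; congr (_ * (_ * _))%N; rewrite mulnC.
by rewrite !leq_mul.
Qed.

Lemma kron_seq_perm_le e ns ns' : perm_eq ns ns' ->
  sum_le (2 ^ e) (aseq (sumn ns)) (kron_seq [seq aseq n | n <- ns]) ->
  sum_le (2 ^ e) (aseq (sumn ns')) (kron_seq [seq aseq n | n <- ns']).
Proof.
move=> eq_ns; have [/tensor_le_sum le' _] := kron_seq_perm aseq eq_ns.
rewrite (perm_sumn eq_ns) => le_e.
by have := sum_le_trans le' le_e; rewrite mul1n.
Qed.

Lemma aseq_split_cat ns1 ns2 e e1 e2 :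
  sum_le (2 ^ e) (aseq (sumn [:: sumn ns1; sumn ns2]))
     (kron_seq [seq aseq n | n <- [:: sumn ns1; sumn ns2]]) ->
  sum_le (2 ^ e1) (aseq (sumn ns1)) (kron_seq [seq aseq n | n <- ns1]) ->
  sum_le (2 ^ e2) (aseq (sumn ns2)) (kron_seq [seq aseq n | n <- ns2]) ->
  sum_le (2 ^ (e + e1 + e2)) (aseq (sumn (ns1 ++ ns2)))
     (kron_seq [seq aseq n | n <- ns1 ++ ns2]).
Proof.
rewrite /= addn0 sumn_cat map_cat => le_e le1 le2.
have le_unit : sum_le 1 (unit_tensor F 1) (unit_tensor F 1).
  exact/tensor_le_sum/tensor_le_refl.
have := sum_le_trans (sum_le_kron le1 (sum_le_kron le2 le_unit)) le_e.
have /tensor_le_sum le_cat : tensor_le (kron (kron_seq [seq aseq n | n <- ns1])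
    (kron (kron_seq [seq aseq n | n <- ns2]) (unit_tensor F 1)))
    (kron_seq ([seq aseq n | n <- ns1] ++ [seq aseq n | n <- ns2])).
  apply: tensor_le_trans (kron_seq_cat _ _).2 _.
  apply: tensor_le_kron (tensor_le_refl _) _.
  exact: tensor_le_trans (kron1 _).1 (kronC_le _ _).
move/(sum_le_trans le_cat); rewrite muln1 mul1n; apply: sum_le_widen.
by rewrite !expnD mulnC mulnA.
Qed.

Lemma aseq_approx (R : realType) : exists2 K : nat -> nat, sublinear R K &
  forall ns, ns != [::] -> sum_le (2 ^ \sum_(n <- ns) K n)
    (aseq (sumn ns)) (kron_seq [seq aseq n | n <- ns]).
Proof.
have /boolp.choice[c cP] := aseq_split.
apply: (@split_sublinear R (fun ns e => sum_le (2 ^ e) (aseq (sumn ns)) (kron_seq [seq aseq n | n <- ns])) _ _ _ c).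
- by move=> ns e e' le_e; apply: sum_le_widen; rewrite leq_exp2l.
- by move=> ns ns' e; apply: kron_seq_perm_le.
- exact: aseq_split_cat.
- by move=> h ns h0; apply: cP.
Qed.

Hypothesis tau_neq0 : forall x, x \in Phi -> tau x != 0.

Lemma typeset_neq0 n : exists s, s \in typeset 'I_(n * k) n.
Proof.
have [x0 _] : exists x0 : T, true.
  apply/existsP; apply: contraTT k_gt0; rewrite negb_exists => /forallP no_x.
  by rewrite -sum_p big1 // => x; have := no_x x.
have [|g lt_g card_g] := @distribute_all 'I_(n * k) [seq n * p x | x <- enum {: T}]%N.
  by rewrite sumnE big_map big_enum /= -big_distrr /= sum_p card_ord.
rewrite size_map in lt_g card_g.
exists [ffun l => nth x0 (enum {: T}) (g l)]; apply/typesetP => x.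
have xT : x \in enum {: T} by rewrite mem_enum.
rewrite -(nth_index x0 xT) -(nth_map x0 0%N (fun x => n * p x)%N) ?index_mem //.
rewrite -card_g ?index_mem //; apply: eq_card => l; rewrite !inE ffunE nth_index //.
apply/eqP/eqP => [<-|->]; last by rewrite nth_index.
by rewrite index_uniq ?enum_uniq.
Qed.

Lemma tens_neq0 (V1 V2 V3 : finType) (t : tens F V1 V2 V3) : t != 0 -> exists q, t q != 0.
Proof.
move=> t0; apply/existsP; apply: contraNT t0; rewrite negb_exists => /forallP t0.
by apply/eqP/ffunP => q; have := t0 q; rewrite negbK ffunE => /eqP.
Qed.

(** A single string is [rect], so its product of nonzero blocks is a restriction of [aseq n]; a
    restriction of zero would vanish. *)
Lemma aseq_neq0 n : tval (aseq n) != 0.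
Proof.
have [s sn] := typeset_neq0 n; apply/eqP => a0.
have /tensor_leP[K1 [K2 [K3 def_s]]] : tensor_le (bsum [set s]) (aseq n).
  apply: (bsum_rect projE).
  - by rewrite finset.sub1set.
  - by move=> s' l; apply: typeset_Phi.
  - move=> s' s1 s2 s3 _ /finset.set1P -> /finset.set1P -> /finset.set1P -> mix.
    by apply/finset.set1P/ffunP => l; rewrite mix; case: (s l) => [[]].
have /boolp.choice[q qP] l : exists q, tau (s l) q != 0.
  exact/tens_neq0/tau_neq0/(typeset_Phi l sn).
have := def_s (ffun_unzip [ffun l => q l]).
rewrite /ker_app big1 => [|q' _]; last by rewrite a0 ffunE mul0r.
rewrite /= ffunE big_set1.
move/eqP; apply/negP/prodf_neq0 => l _; rewrite !ffunE.
by case: (q l) (qP l) => [[]].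
Qed.

End TypeClasses.

(** * Decompositions of tensor powers *)

Section Decompositions.
Variable F : fieldType.

Lemma basis_vec_expansion (X : finType) (v : vec F X) : v = \sum_x v x *: basis_vec F x.
Proof.
apply/ffunP => y; rewrite sum_ffunE (bigD1 y) //= !ffunE eqxx big1 => [|x ne].
  by rewrite addr0 [RHS]mulr1.
by rewrite !ffunE eq_sym (negPf ne) [LHS]mulr0.
Qed.

Lemma hom_kerE (X X' : finType) (f : 'Hom(vec F X, vec F X')) (v : vec F X) x' :
  f v x' = \sum_x v x * hom_ker f x x'.
Proof.
rewrite {1}(basis_vec_expansion v) linear_sum sum_ffunE; apply: eq_bigr => x _.
by rewrite linearZ !ffunE.
Qed.

Section Projections.
Variables (X I : finType) (U : I -> {vspace vec F X}).
Hypothesis decU : is_decomposition U.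

Lemma block_proj_unique (u : vec F X) (v : I -> vec F X) :
  (forall i, v i \in U i) -> \sum_i v i = u -> forall i, block_proj U i u = v i.
Proof.
move=> vU sum_v i; apply/eqP; rewrite -subr_eq0; apply/eqP.
have /directv_sum_independent indep := decU.1.
apply: (indep (fun i => block_proj U i u - v i)) => // [j _|].
  by rewrite rpredB ?vU // memv_sum_pi.
rewrite big_split /= sumrN sum_v sumv_pi_sum ?subrr //.
by rewrite decU.2 memvf.
Qed.

Lemma block_proj_id i j (u : vec F X) : u \in U i -> block_proj U j u = (i == j)%:R *: u.
Proof.
move=> uU; apply: (block_proj_unique (v := fun j => (i == j)%:R *: u)) => [{}j|].
  by case: eqP => [<-|]; rewrite ?scale1r ?scale0r ?mem0v.
rewrite (bigD1 i) //= eqxx scale1r big1 ?addr0 // => l ne.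
by rewrite eq_sym (negPf ne) scale0r.
Qed.

Lemma block_proj_sum (u : vec F X) : \sum_i block_proj U i u = u.
Proof. by rewrite sumv_pi_sum // decU.2 memvf. Qed.

Lemma block_proj_ker_comp i j x x'' :
  \sum_x' hom_ker (block_proj U i) x x' * hom_ker (block_proj U j) x' x'' =
  (i == j)%:R * hom_ker (block_proj U i) x x''.
Proof.
by rewrite -hom_kerE (block_proj_id (i := i)) ?memv_sum_pi // !ffunE.
Qed.

Section Power.
Variable m : nat.

Lemma vbasis_nth_mem (V : {vspace vec F X}) j : (vbasis V)`_j \in V.
Proof.
have [lt_j|ge_j] := ltnP j (size (vbasis V)); first by apply/vbasis_mem/mem_nth.
by rewrite nth_default // mem0v.
Qed.

Lemma vec_prod_mem (i : {ffun 'I_m -> I}) (u : 'I_m -> vec F X) :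
  (forall l, u l \in U (i l)) -> vec_prod u \in pow_decomposition U i.
Proof.
move=> uU.
have coefs l : exists c : 'I_(\dim {:vec F X}) -> F, u l = \sum_j c j *: (vbasis (U (i l)))`_j.
  have le_dim : (\dim (U (i l)) <= \dim {:vec F X})%N by apply: dimvS; apply: subvf.
  (* Indices beyond the dimension of [U (i l)] get the coefficient 0. *)
  exists (fun j => odflt 0 (omap (fun j' => coord (vbasis (U (i l))) j' (u l)) (insub (val j)))).
  rewrite {1}(coord_vbasis (uU l)).
  rewrite (eq_bigr (fun j : 'I__ => odflt 0 (omap (fun j' => coord (vbasis (U (i l))) j' (u l)) (insub (val j))) *: (vbasis (U (i l)))`_j)) => [|j _]; last by rewrite valK.
  rewrite (big_ord_widen _ (fun j => odflt 0 (omap (fun j' => coord (vbasis (U (i l))) j' (u l)) (insub j)) *: (vbasis (U (i l)))`_j) le_dim).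
  rewrite big_mkcond; apply: eq_bigr => j _; case: ltnP => // ge_j.
  by rewrite insubF ?scale0r // ltnNge ge_j.
have /boolp.choice[c cP] := coefs.
have -> : vec_prod u = \sum_(f : {ffun 'I_m -> 'I_(\dim {:vec F X})})
    (\prod_l c l (f l)) *: vec_prod (fun l => (vbasis (U (i l)))`_(f l)).
  apply/ffunP => x; rewrite !ffunE sum_ffunE.
  rewrite (eq_bigr (fun l => \sum_j c l j * (vbasis (U (i l)))`_j (x l))) => [|l _]; last first.
    by rewrite cP sum_ffunE; apply: eq_bigr => j _; rewrite ffunE.
  rewrite bigA_distr_bigA; apply: eq_bigr => f _.
  by rewrite !ffunE big_split.
apply: memv_suml => f _; apply: memvZ.
by apply: (subvP (sumv_sup f _ (subvv _))) => //; rewrite memv_line.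
Qed.

Let pow_ker (j : {ffun 'I_m -> I}) (x x' : {ffun 'I_m -> X}) : F :=
  \prod_l hom_ker (block_proj U (j l)) (x l) (x' l).

(** Products of projections act as the identity on their own summand and as zero on the others,
    which yields independence of the summands. *)
Lemma pow_ker_id (i j : {ffun 'I_m -> I}) w : w \in pow_decomposition U i ->
  ker_fun (pow_ker j) w = (i == j)%:R *: w.
Proof.
move=> /memv_sumP[ws wsU ->]; rewrite linear_sum scaler_sumr; apply: eq_bigr => f _.
have /vlineP[c ->] := wsU f isT.
rewrite linearZ scalerA mulrC -scalerA; congr (_ *: _).
apply/ffunP => x; rewrite !ffunE.
under eq_bigr do rewrite ffunE -big_split /=.
rewrite -(bigA_distr_bigA (fun l y => (vbasis (U (i l)))`_(f l) y * hom_ker (block_proj U (j l)) y (x l))).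
rewrite (eq_bigr (fun l => (i l == j l)%:R * (vbasis (U (i l)))`_(f l) (x l))) => [|l _]; last first.
  by rewrite -hom_kerE (block_proj_id (i := i l)) ?vbasis_nth_mem // ffunE.
by rewrite big_split prod_eq_ffun.
Qed.

(** Multilinear expansion of a product of basis vectors. It shows that the summands span, and by
    uniqueness of components it identifies the projections in [hom_ker_pow]. *)
Lemma vec_prod_block_sum (x : {ffun 'I_m -> X}) :
  \sum_(i : {ffun 'I_m -> I}) vec_prod (fun l => block_proj U (i l) (basis_vec F (x l))) =
  basis_vec F x.
Proof.
apply/ffunP => x'; rewrite sum_ffunE ffunE.
under eq_bigr do rewrite ffunE.
rewrite -(bigA_distr_bigA (fun l i => block_proj U i (basis_vec F (x l)) (x' l))).
rewrite (eq_bigr (fun l => (x' l == x l)%:R)) => [|l _]; last first.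
  by rewrite -[LHS]sum_ffunE block_proj_sum ffunE.
exact: prod_eq_ffun.
Qed.

Lemma pow_decompositionP : is_decomposition (@pow_decomposition F X I m U).
Proof.
split.
  apply/directv_sum_independent => w wU sum_w j _.
  have := congr1 (ker_fun (pow_ker j)) sum_w.
  rewrite linear0 linear_sum (bigD1 j) //= big1 ?addr0 => [|i ne].
    by rewrite (pow_ker_id j (wU j isT)) eqxx scale1r.
  by rewrite (pow_ker_id j (wU i isT)) (negPf ne) scale0r.
apply/vspaceP => v; rewrite memvf.
rewrite (basis_vec_expansion v).
apply: memv_suml => x _; apply: memvZ; rewrite -vec_prod_block_sum.
apply: memv_suml => i _; apply: (subvP (sumv_sup i _ (subvv _))) => //.
by apply: vec_prod_mem => l; apply: memv_sum_pi.
Qed.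

End Power.
End Projections.

Lemma hom_ker_pow (X I : finType) (U : I -> {vspace vec F X}) m (i : {ffun 'I_m -> I}) x x' :
  is_decomposition U ->
  hom_ker (block_proj (@pow_decomposition F X I m U) i) x x' =
  \prod_l hom_ker (block_proj U (i l)) (x l) (x' l).
Proof.
move=> decU; rewrite /hom_ker.
rewrite (block_proj_unique (pow_decompositionP decU m) _ (vec_prod_block_sum decU x)) ?ffunE //.
by move=> j; apply: vec_prod_mem => l; apply: memv_sum_pi.
Qed.

Section Blocks.
Variables (X Y Z A B C : finType) (U : A -> {vspace vec F X})
  (V : B -> {vspace vec F Y}) (W : C -> {vspace vec F Z}) (t : tens F X Y Z).
Hypotheses (decU : is_decomposition U) (decV : is_decomposition V) (decW : is_decomposition W).

Lemma block_projE (p p' : A * B * C) q :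
  ker_app (hom_ker (block_proj U p'.1.1)) (hom_ker (block_proj V p'.1.2))
    (hom_ker (block_proj W p'.2)) (block U V W t p) q =
  (p == p')%:R * block U V W t p q.
Proof.
rewrite /block tens_mapE.
transitivity (ker_app (hom_ker (block_proj U p'.1.1)) (hom_ker (block_proj V p'.1.2))
    (hom_ker (block_proj W p'.2)) (ker_app (hom_ker (block_proj U p.1.1))
    (hom_ker (block_proj V p.1.2)) (hom_ker (block_proj W p.2)) t) q).
  by apply: eq_bigr => q' _; rewrite tens_mapE.
rewrite ker_app_comp /ker_app mulr_sumr; apply: eq_bigr => q' _.
rewrite !block_proj_ker_comp //.
move: p p' => [[a b] c] [[a' b'] c'] /=; rewrite !xpair_eqE -!mulnb !natrM.
by ring.
Qed.

Lemma block_pow m (s : {ffun 'I_m -> A * B * C}) q :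
  block (@pow_decomposition F X A m U) (@pow_decomposition F Y B m V)
    (@pow_decomposition F Z C m W) (tens_pow m t) (unzip3 s) q =
  \prod_l block U V W t (s l) (q.1.1 l, q.1.2 l, q.2 l).
Proof.
rewrite /block tens_mapE.
under [RHS]eq_bigr do rewrite tens_mapE.
rewrite -(ker_app_prod (fun l => hom_ker (block_proj U (s l).1.1))
  (fun l => hom_ker (block_proj V (s l).1.2)) (fun l => hom_ker (block_proj W (s l).2)) (fun=> t)).
apply: eq_bigr => q' _; rewrite !hom_ker_pow // ffunE; congr (_ * (_ * _ * _)).
- by apply: eq_bigr => l _; rewrite ffunE.
- by apply: eq_bigr => l _; rewrite ffunE.
- by apply: eq_bigr => l _; rewrite ffunE.
Qed.

Lemma block_restr_pow m (D : {set {ffun 'I_m -> A * B * C}}) :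
  block_restr (@pow_decomposition F X A m U) (@pow_decomposition F Y B m V)
    (@pow_decomposition F Z C m W) (tens_pow m t) [set unzip3 s | s in D] =
  bsum_val (block U V W t) D.
Proof.
rewrite /block_restr big_imset /=; last by move=> s s' _ _; apply: (can_inj (@ffun_unzipK A B C _)).
apply/ffunP => q; rewrite sum_ffunE ffunE; apply: eq_bigr => s _; exact: block_pow.
Qed.

End Blocks.
End Decompositions.

(** * From distributions to integer counts, and the theorem *)

Lemma marginal_count_inj (R : realType) (A B C : finType) (Phi : {set A * B * C})
    (marg_inj : forall P Q : {ffun A * B * C -> R},
       is_distr Phi P -> is_distr Phi Q -> marginals P = marginals Q -> P = Q)
    (q q' : A * B * C -> nat) :
  (forall x, x \notin Phi -> q x = 0%N) -> (forall x, x \notin Phi -> q' x = 0%N) ->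
  (forall a, \sum_(x | x.1.1 == a) q x = \sum_(x | x.1.1 == a) q' x)%N ->
  (forall b, \sum_(x | x.1.2 == b) q x = \sum_(x | x.1.2 == b) q' x)%N ->
  (forall c, \sum_(x | x.2 == c) q x = \sum_(x | x.2 == c) q' x)%N -> q =1 q'.
Proof.
move=> q0 q'0 eqA eqB eqC.
pose S := (\sum_x q x)%N.
have S' : S = (\sum_x q' x)%N.
  rewrite /S (partition_big (fun x => x.1.1) xpredT) //=.
  by rewrite [RHS](partition_big (fun x => x.1.1) xpredT) //=; apply: eq_bigr.
(* Counts of total 0 cannot be normalized to distributions, but they all vanish. *)
have [S0|S0] := posnP S.
  move=> x; have/eqP := S0; rewrite /S sum_nat_eq0 => /forallP/(_ x)/eqP ->.
  by move: S0; rewrite S' => /eqP; rewrite sum_nat_eq0 => /forallP/(_ x)/eqP ->.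
have SR : S%:R != 0 :> R by rewrite pnatr_eq0 -lt0n.
pose norm (f : A * B * C -> nat) : {ffun A * B * C -> R} := [ffun x => (f x)%:R / S%:R].
have sum_norm (P : pred (A * B * C)) f :
    \sum_(x | P x) norm f x = (\sum_(x | P x) f x)%:R / S%:R.
  by rewrite natr_sum mulr_suml; apply: eq_bigr => x _; rewrite ffunE.
have distr f : (forall x, x \notin Phi -> f x = 0%N) -> S = (\sum_x f x)%N ->
    is_distr Phi (norm f).
  move=> f0 Sf; split=> [x||x xPhi]; first by rewrite ffunE divr_ge0.
    by rewrite sum_norm -Sf divff.
  by rewrite ffunE f0 // mul0r.
have/ffunP eq_norm : norm q = norm q'.
  apply: marg_inj; [exact: distr | exact: distr |].
  by congr (_, _, _); apply/ffunP => v; rewrite !ffunE !sum_norm ?eqA ?eqB ?eqC.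
move=> x; have := eq_norm x; rewrite !ffunE => /(divIf SR)/eqP.
by rewrite eqr_nat => /eqP.
Qed.

Local Open Scope complex_scope.

Theorem theorem5p19 (R : realType) (X Y Z A B C : finType)
  (U : A -> {vspace vec R[i] X}) (V : B -> {vspace vec R[i] Y})
  (W : C -> {vspace vec R[i] Z})
  (decU : is_decomposition U) (decV : is_decomposition V) (decW : is_decomposition W)
  (t : tens R[i] X Y Z) (Phi : {set A * B * C}) (defPhi : Phi = block_supp U V W t)
  (marg_inj : forall P Q : {ffun A * B * C -> R},
     is_distr Phi P -> is_distr Phi Q -> marginals P = marginals Q -> P = Q)
  (k : nat) (k_gt0 : (0 < k)%N)
  (P : {ffun A * B * C -> R}) (typeP : is_ntype k Phi P) :
  approx_geometric R (fun n : nat =>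
    Tensor
      (block_restr
         (@pow_decomposition R[i] X A (n * k) U)
         (@pow_decomposition R[i] Y B (n * k) V)
         (@pow_decomposition R[i] Z C (n * k) W)
         (tens_pow (n * k) t)
         [set unzip3 s | s in type_class (n * k) P])).
Proof.
have [[P_ge0 sumP P_supp] /boolp.choice[p pE]] := typeP.
pose tau := block U V W t.
have kR : k%:R != 0 :> R by rewrite pnatr_eq0 -lt0n.
have sum_p : (\sum_x p x = k)%N.
  apply/eqP; rewrite -(eqr_nat R) natr_sum; apply/eqP.
  by under eq_bigr do rewrite -pE; rewrite -mulr_sumr sumP mulr1.
have p_supp x : x \notin Phi -> p x = 0%N.
  by move=> /P_supp Px; apply/eqP; rewrite -(eqr_nat R) -pE Px mulr0.
have tau_neq0 x : x \in Phi -> tau x != 0 by rewrite defPhi inE.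
have typeE n : type_class (n * k) P = typeset p 'I_(n * k) n.
  apply/finset.setP => s; rewrite !inE; apply: eq_forallb => x.
  by rewrite natrM -mulrA pE -natrM eqr_nat.
pose EA a := hom_ker (block_proj U a).
pose EB b := hom_ker (block_proj V b).
pose EC c := hom_ker (block_proj W c).
have projE (x x' : A * B * C) q :
    ker_app (EA x'.1.1) (EB x'.1.2) (EC x'.2) (tau x) q = (x == x')%:R * tau x q.
  exact: block_projE.
have count_inj := marginal_count_inj marg_inj.
have -> : (fun n : nat => Tensor (block_restr (@pow_decomposition R[i] X A (n * k) U)
    (@pow_decomposition R[i] Y B (n * k) V) (@pow_decomposition R[i] Z C (n * k) W)
    (tens_pow (n * k) t) [set unzip3 s | s in type_class (n * k) P])) = aseq tau p k.
  by apply/funext => n; rewrite block_restr_pow // typeE.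
right; split; first by move=> n; apply: (aseq_neq0 projE sum_p k_gt0 p_supp tau_neq0).
have [K subK KP] := aseq_approx projE count_inj sum_p k_gt0 p_supp R.
exists K => // ns ns0 /=.
have -> : (\sum_(n <- ns) n)%N = sumn ns by rewrite sumnE.
(* The product restricts from [a_sum] without loss; one summand is merely widened to [2 ^ e]. *)
split; apply: sum_le_tensor_le; last exact: KP.
have /tensor_le_sum le1 := kron_seq_le_aseq projE count_inj k p_supp ns.
by apply: sum_le_widen le1; rewrite expn_gt0.
Qed.
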